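(* Let $n\ge2$ and let $(\tau_k,k\ge0)$ be the Markov chain on $\mathbb T_n^o$ with the transition rule described in the context. Then $\mathbb T_n^{b,o}$ is the only closed communicating class of $(\tau_k,k\ge0)$, the chain has a unique stationary distribution $\pi$, which is supported by $\mathbb T_n^{b,o}$, and the distribution of $\tau_k$ converges to $\pi$ as $k\to\infty$.
   Context: $\mathbb T_n^o$ is the set of rooted unlabelled (combinatorial) trees with $n$ leaves in which no vertex other than the root has degree two; $\mathbb T_n^{b,o}\subset\mathbb T_n^o$ consists of the binary ones, i.e. root of degree one and all other non-leaf vertices of degree three. Trees are viewed as $\mathbb R$-trees with unit edge lengths, and each tree with $m$ leaves carries the uniform probability on its leaves. For a rooted tree and a subtree $\mathcal R\ni\rho$, $\pi^{\mathcal R}(\sigma)$ is the point of the path from $\rho$ to $\sigma$ in $\mathcal R$ farthest from $\rho$. Transition rule: given $\tau_0=T$ with root $\rho$: (i) choose an edge $u\to v$ of $T$ uniformly at random and replace it by edges $u\to w$, $w\to v$, $w\to\ell$ with a new vertex $w$ and new leaf $\ell$, giving $T_{+1}$ with $n+1$ leaves; (ii) choose two distinct leaves $\Sigma_1,\widetilde\Sigma_1$ of $T_{+1}$ uniformly at random; let $\Omega$ be the branch point of the reduced tree $\mathcal R_2$ spanned by $\rho,\Sigma_1,\widetilde\Sigma_1$; (iii) assign labels $2,\ldots,n$ to the remaining $n-1$ leaves by a uniform random bijection; (iv) with branches $E_1=[[\rho,\Omega[[$, $E_2=]]\Omega,\Sigma_1[[$, $E_3=[[\Omega,\widetilde\Sigma_1[[$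 (left endpoints $\rho,\Omega,\Omega$), subtrees $\mathcal S_x=(\pi^{\mathcal R_2})^{-1}(x)$, masses $\mu_{\mathcal R_2}(x)=\mu(\mathcal S_x)$, let $Y_j:=\pi^{\mathcal R_2}(\text{leaf labelled }j)$, $j=2,\ldots,n$. Cut points: $E_i^{(1)}=E_i$, $J_0=1$; $X_k=Y_{J_k}$ with $J_k=\min\{j>J_{k-1}:Y_j\in E^{(k)}\}$, $E^{(k)}=\bigcup_iE_i^{(k)}$ (while such $j$ exists), and $E_i^{(k+1)}=E_i^{(k)}\setminus[[\rho_i,X_k]]$ if $X_k\in E_i^{(k)}$, otherwise unchanged. The block $B_k$ is the segment of the branch of $X_k$ from the previous cut point on that branch (excluded), or from the branch's start point if there is none, up to $X_k$ (included). The new spine is $\rho$ followed by the concatenation $B_1,B_2,\ldots$ in order, followed by the leaf $\Sigma_1$ (parts of branches beyond their last cut point contain no vertices); if a start point $\rho$ or $\Omega$ lies in a block which is not the first, it is identified with the endpoint of the preceding block and the subtrees hanging there are joined at their roots. Each $\mathcal S_x$ is reattached at $x$; the leaf $\widetilde\Sigma_1$ is lost. Forgetting labels and edge lengths gives $\tau_1\in\mathbb T_n^o$. *)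

(* Defs.v *)
From HB Require Import structures.
From mathcomp Require Import all_boot all_order all_algebra.
From mathcomp Require Import boolp classical_sets reals topology normedtype sequences.

Set Implicit Arguments.
Unset Strict Implicit.
Unset Printing Implicit Defensive.
Import Order.TTheory GRing.Theory Num.Theory.

(* Rooted combinatorial trees as rose trees.  A tree is a root with a list   *)
(* of children; unordered (unlabelled) trees are identified through the      *)
(* canonical form [canon] (children recursively sorted).                     *)

Inductive rtree := Node of seq rtree.

Definition children (t : rtree) : seq rtree := let: Node s := t in s.
Definition leafT : rtree := Node [::].

Fixpoint rtree_enc (t : rtree) : GenTree.tree unit :=
  let: Node s := t in GenTree.Node 0 (map rtree_enc s).
Fixpoint rtree_dec (g : GenTree.tree unit) : rtree :=
  match g with
  | GenTree.Leaf _ => Node [::]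
  | GenTree.Node _ s => Node (map rtree_dec s)
  end.
Lemma rtree_encK : cancel rtree_enc rtree_dec.
Proof.
rewrite /cancel; fix IH 1; case=> s /=; congr Node; elim: s => //= a s IHs.
by rewrite IH IHs.
Qed.
HB.instance Definition _ := Countable.copy rtree (can_type rtree_encK).

Fixpoint rcmp (t u : rtree) : comparison :=
  let: Node s := t in let: Node r := u in
  (fix aux (s r : seq rtree) : comparison :=
     match s, r with
     | [::], [::] => Eq
     | [::], _ => Lt
     | _, [::] => Gt
     | x :: s', y :: r' =>
         match rcmp x y with Eq => aux s' r' | c => c end
     end) s r.
Definition rle (t u : rtree) : bool := if rcmp t u is Gt then false else true.

Fixpoint canon (t : rtree) : rtree :=
  let: Node s := t in Node (sort rle (map canon s)).

(* vertices are addressed by the sequence of child indices from the root *)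
Definition addr := seq nat.

Fixpoint subt (t : rtree) (p : addr) : rtree :=
  match p with
  | [::] => t
  | i :: p' => subt (nth leafT (children t) i) p'
  end.

Fixpoint addrs (t : rtree) : seq addr :=
  let: Node s := t in
  [::] :: (fix aux (i : nat) (s : seq rtree) : seq addr :=
             match s with
             | [::] => [::]
             | c :: s' => map (cons i) (addrs c) ++ aux i.+1 s'
             end) 0%N s.

Definition leaves (t : rtree) : seq addr :=
  [seq p <- addrs t | (p != [::]) && (children (subt t p) == [::])].

Definition nleaves (t : rtree) : nat := size (leaves t).

Definition inner (t : rtree) : seq addr :=
  [seq p <- addrs t | (p != [::]) && (children (subt t p) != [::])].

(* edges u -> v are identified with their lower endpoint v (a non-root vertex) *)
Definition edges (t : rtree) : seq addr := [seq p <- addrs t | p != [::]].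

(* T_n^o : n leaves, no non-root vertex of degree two (i.e. with one child) *)
Definition in_To (n : nat) (t : rtree) : bool :=
  (nleaves t == n) && all (fun p => 2 <= size (children (subt t p)))%N (inner t).

(* T_n^{b,o} : root of degree one, all other internal vertices of degree 3 *)
Definition in_Tbo (n : nat) (t : rtree) : bool :=
  (nleaves t == n) && (size (children t) == 1%N)
  && all (fun p => size (children (subt t p)) == 2%N) (inner t).

Definition is_state (n : nat) (t : rtree) : bool := (canon t == t) && in_To n t.

Fixpoint forests (fuel k : nat) : seq (seq rtree) :=
  match fuel with
  | 0 => [::]
  | fuel'.+1 =>
      if k == 0%N then [:: [::]] else
      flatten [seq [seq Node f :: g | f <- forests fuel' a.-1, g <- forests fuel' (k - a)]
              | a <- iota 1 k]
  end.

Definition candidates (N : nat) : seq rtree :=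
  flatten [seq [seq Node f | f <- forests k.+1 k] | k <- iota 0 N].

(* a tree in T_n^o has at most 2n vertices *)
Definition state_list (n : nat) : seq rtree :=
  [seq t <- candidates (2 * n) | is_state n t].

Definition state (n : nat) := seq_sub (state_list n).

Definition binary_states (n : nat) : {set state n} :=
  [set s | in_Tbo n (ssval s)].

Fixpoint replace (t : rtree) (p : addr) (u : rtree) : rtree :=
  match p with
  | [::] => u
  | i :: p' => Node (set_nth leafT (children t) i
                       (replace (nth leafT (children t) i) p' u))
  end.

Definition insert_leaf (t : rtree) (v : addr) : rtree :=
  replace t v (Node [:: subt t v; leafT]).

Fixpoint lcp (a b : addr) : addr :=
  match a, b with
  | x :: a', y :: b' => if x == y then x :: lcp a' b' else [::]
  | _, _ => [::]
  end.

Section Step.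
Variables (T1 : rtree) (a b : addr).
(* a = Sigma_1, b = tilde Sigma_1 ; Omega = branch point *)
Definition Omega : addr := lcp a b.

(* projection onto the reduced tree R_2 spanned by root, a, b *)
Definition proj (x : addr) : addr :=
  if (size (lcp x b) <= size (lcp x a))%N then lcp x a else lcp x b.

(* branch of a point of R_2 (1: [rho,Omega[, 2: ]Omega,a[, 3: [Omega,b[ )
   and its distance to the start point of its branch *)
Definition branch (x : addr) : nat :=
  if (size x < size Omega)%N then 1%N
  else if x == Omega then 3%N
  else if prefix x a then 2%N else 3%N.
Definition dist (x : addr) : nat :=
  if (size x < size Omega)%N then size x else (size x - size Omega)%N.

(* cut points: a block is (branch, previous cut on that branch, new cut) *)
Fixpoint cuts (cur : nat -> option nat) (ys : seq addr)
  : seq (nat * option nat * nat) :=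
  match ys with
  | [::] => [::]
  | y :: ys' =>
      let i := branch y in let d := dist y in
      if (if cur i is Some c then (c < d)%N else true)
      then (i, cur i, d) :: cuts (fun k => if k == i then Some d else cur k) ys'
      else cuts cur ys'
  end.

(* the points of positive mass (projections of labelled leaves) of a block,
   in increasing distance from the start of the branch *)
Definition block_points (ys : seq addr) (blk : nat * option nat * nat) : seq addr :=
  let: (i, lo, hi) := blk in
  [seq x <- sort (fun x y => dist x <= dist y)%N (undup ys)
   | (branch x == i) && (if lo is Some c then (c < dist x)%N else true)
     && (dist x <= hi)%N].

(* closed start points rho (branch 1) and Omega (branch 3) are identified
   with the endpoint of the preceding block (with the root for the first) *)
Definition merges (x : addr) : bool := (dist x == 0%N) && (branch x != 2%N).

Definition grp_step (acc : seq addr * seq (seq addr)) (x : addr) :=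
  let: (cur, done) := acc in
  if merges x then (x :: cur, done) else ([:: x], cur :: done).

Definition groups (pts : seq addr) : seq (seq addr) :=
  let: (cur, done) := foldl grp_step ([::], [::]) pts in rev (cur :: done).

Definition hang (x : addr) : seq rtree :=
  [seq subt T1 (rcons x i)
  | i <- iota 0 (size (children (subt T1 x)))
  & ~~ (prefix (rcons x i) a || prefix (rcons x i) b)].

(* new spine: root group, then the successive positions, then the leaf a *)
Fixpoint spine (gs : seq (seq addr)) : rtree :=
  match gs with
  | [::] => leafT
  | g :: gs' => Node (flatten (map hang g) ++ [:: spine gs'])
  end.

(* perm = leaves labelled 2, 3, ..., n in this order *)
Definition new_tree (perm : seq addr) : rtree :=
  let ys := map proj perm in
  canon (spine (groups (flatten (map (block_points ys) (cuts (fun _ => None) ys))))).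
End Step.

Local Open Scope ring_scope.

Definition avg {R : numFieldType} {X : Type} (s : seq X) (f : X -> R) : R :=
  (\sum_(x <- s) f x) / (size s)%:R.

Definition trans_prob {R : numFieldType} (T T' : rtree) : R :=
  avg (edges T) (fun v =>
    let T1 := insert_leaf T v in
    let L := leaves T1 in
    avg [seq (x, y) | x <- L, y <- [seq y <- L | y != x]] (fun ab =>
      avg (permutations [seq l <- L | (l != ab.1) && (l != ab.2)]) (fun perm =>
        (new_tree T1 ab.1 ab.2 perm == T')%:R))).

Definition P {R : numFieldType} (n : nat) (s t : state n) : R :=
  trans_prob (ssval s) (ssval t).

Section Markov.
Variables (R : realType) (S : finType) (K : S -> S -> R).

Definition is_distr (mu : S -> R) : Prop :=
  (forall s, 0 <= mu s) /\ \sum_s mu s = 1.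

Fixpoint law (mu0 : S -> R) (k : nat) : S -> R :=
  match k with
  | 0 => mu0
  | k'.+1 => fun t => \sum_s law mu0 k' s * K s t
  end.

Definition stationary (pi : S -> R) : Prop :=
  is_distr pi /\ forall t, \sum_s pi s * K s t = pi t.

Definition leads (s t : S) : bool := connect (fun x y => 0 < K x y) s t.
Definition communicate (s t : S) : bool := leads s t && leads t s.

Definition comm_class (C : {set S}) : Prop :=
  exists s, C = [set t | communicate s t].

Definition closed_class (C : {set S}) : Prop :=
  forall s t, s \in C -> 0 < K s t -> t \in C.
End Markov.

(* Main.v *)
Require Import Defs.
From HB Require Import structures.
From mathcomp Require Import all_boot all_order all_algebra.
From mathcomp Require Import boolp classical_sets reals topology normedtype sequences.
From mathcomp Require Import zify ring.
Import Order.TTheory GRing.Theory Num.Theory numFieldNormedType.Exports.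

(* Write the reduced tree of a step as three branches carrying the subtrees   *)
(* hanging off them.  For any choice in the step, the cut-point construction  *)
(* lists every point of positive mass exactly once, so the subtrees are       *)
(* conserved and the new tree is again a state, binary if the old one was.    *)
(* Conversely, listing the labels by projection produces every order of the   *)
(* points that is increasing along each branch.  Three choices suffice.       *)
(* - Killing a leaf of a cherry: the step inserts a leaf and deletes another. *)
(*   On binary trees such moves are reversible (both trees are obtained from  *)
(*   a common tree by deleting a leaf), include the trivial move, and connect *)
(*   every tree to a comb.                                                    *)
(* - If the root has two children, taking Omega to be the root gives one      *)
(*   vertex more.                                                             *)
(* - If the root has one child but the tree is not binary, taking Omega to be *)
(*   a vertex of higher degree, first in the order, moves its subtrees to the *)
(*   root and keeps the number of vertices.                                   *)
(* A state has at most 2n vertices, so binary trees are always reached.  All  *)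
(* states thus lead to one binary state with a loop, and some power of the    *)
(* kernel satisfies Doeblin's condition.                                      *)

Set Implicit Arguments.
Unset Strict Implicit.
Unset Printing Implicit Defensive.

(** A finite chain in which every state leads to one state with a loop has, for some power of its
    kernel, a column bounded below by a positive constant. Applying that power shrinks the
    oscillation of every function by a fixed factor ([contract]), so all laws merge and converge
    ([law_cauchy], [chain_converges]). Trees therefore have to supply three facts: the binary states
    are closed ([binary_closed]), they communicate and have loops ([binary_leads], [binary_loop]),
    and every state leads to one of them ([reach_binary]).

    All three rest on a normal form of the step. Two distinct leaves have addresses [w ++ i :: a']
    and [w ++ j :: b'] with [i != j], where [w] is Omega, and up to the order of children the tree
    is given by the forests hanging along the three branches ([decomp]). The points of positive mass
    are the vertices with a nonempty forest ([perm_points]), and the blocks list each of them once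
    ([perm_pts]); this gives the leaf count and the degrees of the new tree ([new_tree_To],
    [new_tree_Tbo]). In the other direction, [pts_shuffle] prescribes the order of the points, and
    [new_tree_key] computes the outcome for one order: Omega at the beginning, then the rest of the
    three branches one after the other. Every transition that has to be exhibited is an instance of
    it: [step_del], [to_root_two] and [to_root_one]. *)

Local Notation canon := Defs.canon.

(** * Trees up to reordering of children *)

(** The principle generated for this nested inductive type gives no hypothesis about the children;
    this one does, by membership. *)
Lemma rtree_elim (Q : rtree -> Prop) :
  (forall s, (forall x, x \in s -> Q x) -> Q (Node s)) -> forall t, Q t.
Proof.
(* [IH] is cleared so that automation cannot close the empty case by an unguarded recursive call. *)
move=> H; fix IH 1; case=> s; apply: H; elim: s => [x|a s IHs x]; first by clear IH; rewrite in_nil.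
rewrite inE => /orP [/eqP->|xs]; [apply: IH | apply: IHs xs].
Qed.

(** Names the local fixpoint of [rcmp], so that inductions on lists of children can be stated. *)
Fixpoint lcmp (s r : seq rtree) : comparison :=
  match s, r with
  | [::], [::] => Eq
  | [::], _ => Lt
  | _, [::] => Gt
  | x :: s', y :: r' => match rcmp x y with Eq => lcmp s' r' | c => c end
  end.

Lemma rcmpE s r : rcmp (Node s) (Node r) = lcmp s r.
Proof. by elim: s r => [|x s IH] [|y r] //=; rewrite -IH. Qed.

Lemma rcmp_opp t u : rcmp u t = CompOpp (rcmp t u).
Proof.
elim/rtree_elim: t u => s IH [r]; rewrite !rcmpE.
elim: s r IH => [|x s IHs] [|y r] IH //=.
rewrite (IH x) ?mem_head //; case: (rcmp x y) => //=.
by apply: IHs => z zs; apply: IH; rewrite inE zs orbT.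
Qed.

Lemma rcmp_eq t u : rcmp t u = Eq -> t = u.
Proof.
elim/rtree_elim: t u => s IH [r]; rewrite rcmpE => H; congr Node.
elim: s r IH H => [|x s IHs] [|y r] IH //=.
case E: (rcmp x y) => // H.
rewrite (IH x _ _ E) ?mem_head //; congr (_ :: _); apply: IHs => // z zs.
by apply: IH; rewrite inE zs orbT.
Qed.

Lemma rcmp_lt_trans t u v : rcmp t u = Lt -> rcmp u v = Lt -> rcmp t v = Lt.
Proof.
elim/rtree_elim: t u v => s IH [r] [q]; rewrite !rcmpE.
elim: s r q IH => [|x s IHs] [|y r] [|z q] IH //=.
case E1: (rcmp x y); case E2: (rcmp y z) => // H1 H2.
- rewrite (rcmp_eq E1) E2; apply: IHs H1 H2 => c cs; apply: IH.
  by rewrite inE cs orbT.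
- by rewrite (rcmp_eq E1) E2.
- by rewrite -(rcmp_eq E2) E1.
- by rewrite (IH x _ _ _ E1 E2) ?mem_head.
Qed.

Lemma rle_total : total rle.
Proof. by move=> t u; rewrite /rle (rcmp_opp t u); case: rcmp. Qed.

Lemma rle_anti : antisymmetric rle.
Proof.
move=> t u; rewrite /rle (rcmp_opp t u).
by case E: (rcmp t u) => //= _; apply: rcmp_eq.
Qed.

Lemma rle_trans : transitive rle.
Proof.
move=> u t v; rewrite /rle.
case E1: (rcmp t u); case E2: (rcmp u v) => // _ _.
- by rewrite (rcmp_eq E1) E2.
- by rewrite (rcmp_eq E1) E2.
- by rewrite -(rcmp_eq E2) E1.
- by rewrite (rcmp_lt_trans E1 E2).
Qed.

(** Equality of the underlying unordered trees. *)
Definition teq t u := canon t = canon u.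

(** Sorting by a total order identifies exactly the permuted lists. With this one-level description
    later arguments about [teq] need not look at [rle]. *)
Lemma teq_node s r :
  teq (Node s) (Node r) <-> perm_eq (map canon s) (map canon r).
Proof.
rewrite /teq /=; split => [[H]|H].
  by rewrite -(perm_sort rle) H perm_sort.
by congr Node; apply/(perm_sortP rle_total rle_trans rle_anti).
Qed.

Lemma canon_id t : canon (canon t) = canon t.
Proof.
elim/rtree_elim: t => s IH /=; congr Node.
have -> : map canon (sort rle (map canon s)) = sort rle (map canon s).
  rewrite -[RHS]map_id; apply/eq_in_map => x; rewrite mem_sort.
  by case/mapP=> y ys ->; apply: IH.
by rewrite sorted_sort ?sort_sorted //; [apply: rle_trans | apply: rle_total].
Qed.

Lemma teq_canon t : teq (canon t) t. Proof. exact: canon_id. Qed.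

Lemma teq_perm s r : perm_eq s r -> teq (Node s) (Node r).
Proof. by move=> H; apply/teq_node/perm_map. Qed.

Lemma teq_cat s r t u : teq t u -> perm_eq s r -> teq (Node (s ++ [:: t])) (Node (r ++ [:: u])).
Proof.
move=> tu sr; apply/teq_node; rewrite !map_cat /= tu perm_cat2r.
exact: perm_map.
Qed.

Lemma teq_leaf t : teq t leafT -> t = leafT.
Proof. by case: t => s [] /(congr1 size); rewrite size_sort size_map; case: s. Qed.

(** * Invariants of unordered trees *)

(** A childless root counts as a leaf here, unlike in [nleaves]; this makes the count additive over
    subtrees. *)
Fixpoint num_leaves t := let: Node s := t in
  if s is [::] then 1 else sumn (map num_leaves s).
Fixpoint tree_size t := let: Node s := t in (sumn (map tree_size s)).+1.
Fixpoint nodeall (Q : pred nat) t := let: Node s := t in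
  Q (size s) && all (nodeall Q) s.

Lemma num_leaves_node s : s != [::] -> num_leaves (Node s) = sumn (map num_leaves s).
Proof. by case: s. Qed.

Lemma num_leaves_gt0 t : 0 < num_leaves t.
Proof.
elim/rtree_elim: t => -[|x s] IH //=.
by rewrite ltn_addr // IH ?mem_head.
Qed.

Lemma perm_sumn s r : perm_eq s r -> sumn s = sumn r.
Proof. by move=> H; rewrite !sumnE; apply: perm_big. Qed.

Lemma canon_nil s : (sort rle (map canon s) == [::]) = (s == [::]).
Proof. by rewrite -!size_eq0 size_sort size_map. Qed.

Lemma map_canon_eq (A : eqType) (f : rtree -> A) s : {in s, forall x, f (canon x) = f x} ->
  perm_eq (map f (sort rle (map canon s))) (map f s).
Proof.
move=> H; have -> : map f s = map f (map canon s).
  by rewrite -map_comp; apply/eq_in_map => x xs /=; rewrite H.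
by apply: perm_map; rewrite perm_sort.
Qed.

Lemma num_leaves_canon t : num_leaves (canon t) = num_leaves t.
Proof.
elim/rtree_elim: t => s IH; case: (eqVneq s [::]) => [->//|s0].
by rewrite [LHS]num_leaves_node ?canon_nil // num_leaves_node //; apply/perm_sumn/map_canon_eq.
Qed.

Lemma tree_size_canon t : tree_size (canon t) = tree_size t.
Proof. by elim/rtree_elim: t => s IH /=; congr _.+1; apply/perm_sumn/map_canon_eq. Qed.

Lemma nodeall_canon Q t : nodeall Q (canon t) = nodeall Q t.
Proof.
elim/rtree_elim: t => s IH /=; rewrite size_sort size_map; congr (_ && _).
have H := map_canon_eq IH.
have E r : all (nodeall Q) r = all id (map (nodeall Q) r) by rewrite all_map.
by rewrite !E (perm_all _ H).
Qed.

Lemma num_leaves_teq t u : teq t u -> num_leaves t = num_leaves u.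
Proof. by move=> H; rewrite -num_leaves_canon H num_leaves_canon. Qed.
Lemma tree_size_teq t u : teq t u -> tree_size t = tree_size u.
Proof. by move=> H; rewrite -tree_size_canon H tree_size_canon. Qed.
Lemma size_children_canon t : size (children (canon t)) = size (children t).
Proof. by case: t => s /=; rewrite size_sort size_map. Qed.

Lemma all_children_canon Q t :
  all (nodeall Q) (children (canon t)) = all (nodeall Q) (children t).
Proof.
have := nodeall_canon (fun=> true) t; case: t => s _ /=.
have H := @map_canon_eq _ (nodeall Q) s (fun x _ => nodeall_canon Q x).
have E r : all (nodeall Q) r = all id (map (nodeall Q) r) by rewrite all_map.
by rewrite !E (perm_all _ H).
Qed.

(** * Addresses *)

Fixpoint valid t (p : addr) :=
  match p with
  | [::] => true
  | i :: q => (i < size (children t)) && valid (nth leafT (children t) i) q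
  end.

(** Names the local fixpoint of [addrs]. *)
Fixpoint addrs_from i (s : seq rtree) : seq addr :=
  if s is c :: s' then map (cons i) (addrs c) ++ addrs_from i.+1 s' else [::].

Lemma addrsE s : addrs (Node s) =
  [::] :: flatten [seq map (cons i) (addrs (nth leafT s i)) | i <- iota 0 (size s)].
Proof.
rewrite -[addrs (Node s)]/([::] :: addrs_from 0 s); congr (_ :: _).
suff H k : addrs_from k s = flatten [seq map (cons (k + i)) (addrs (nth leafT s i)) | i <- iota 0 (size s)] by rewrite H.
elim: s k => [|c s IH] k //=; rewrite addn0; congr (_ ++ _).
rewrite IH -[1]/(1 + 0) iotaDl -map_comp; congr flatten; apply: eq_map => i /=.
by rewrite addSnnS.
Qed.

Lemma mem_addrs t p : (p \in addrs t) = valid t p.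
Proof.
elim: p t => [|i p IH] [s]; rewrite addrsE inE //=.
apply/flatten_mapP/andP => [[j]|[Hi Hv]].
  by rewrite mem_iota => /= Hj /mapP [q Hq [-> E]]; rewrite -IH E.
by exists i; rewrite ?mem_iota //=; apply/mapP; exists p; rewrite // IH.
Qed.

Lemma subt_cat t p q : subt t (p ++ q) = subt (subt t p) q.
Proof. by elim: p t => //= i p IH t; rewrite IH. Qed.

Lemma valid_cat t p q : valid t (p ++ q) = valid t p && valid (subt t p) q.
Proof. by elim: p t => //= i p IH t; rewrite IH andbA. Qed.

Lemma mem_leaves t p :
  (p \in leaves t) = [&& p != [::], children (subt t p) == [::] & valid t p].
Proof. by rewrite mem_filter mem_addrs andbA. Qed.

Lemma mem_edges t p : (p \in edges t) = (p != [::]) && valid t p.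
Proof. by rewrite mem_filter mem_addrs. Qed.

Lemma count_flatten_map (A B : Type) (a : pred B) (f : A -> seq B) s :
  count a (flatten (map f s)) = sumn [seq count a (f x) | x <- s].
Proof. by rewrite count_flatten -map_comp. Qed.

Lemma map_nth_rtree (A : Type) (f : rtree -> A) s :
  [seq f (nth leafT s i) | i <- iota 0 (size s)] = map f s.
Proof. by rewrite (map_comp f (nth leafT s)) map_nth_iota0 // take_size. Qed.

Lemma count_leaf t : count (fun p => children (subt t p) == [::]) (addrs t) = num_leaves t.
Proof.
elim/rtree_elim: t => s IH; rewrite addrsE /= count_flatten_map.
have -> : [seq count (fun p => children (subt (Node s) p) == [::])
    [seq i :: p | p <- addrs (nth leafT s i)] | i <- iota 0 (size s)] = map num_leaves s.
  rewrite -(map_nth_rtree num_leaves); apply/eq_in_map => i; rewrite mem_iota /= => Hi.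
  by rewrite count_map -(IH (nth leafT s i)) ?mem_nth.
by case: (s).
Qed.

Lemma nleavesE t : nleaves t = sumn (map num_leaves (children t)).
Proof.
case: t => s; rewrite /nleaves /leaves size_filter addrsE /= count_flatten_map.
congr sumn; rewrite -(map_nth_rtree num_leaves); apply/eq_map => i /=.
by rewrite count_map -count_leaf; apply: eq_count => p /=.
Qed.

Lemma nodeallE Q t : nodeall (fun k => (k == 0) || Q k) t =
  all (fun p => (children (subt t p) != [::]) ==> Q (size (children (subt t p)))) (addrs t).
Proof.
elim/rtree_elim: t => s IH; rewrite addrsE /=; congr (_ && _).
  by rewrite implybE negbK -size_eq0.
rewrite -[in LHS](map_id s) -(map_nth_rtree id) all_map -(map_id (flatten _)) all_map.
apply/allP/allP => /= [H p /flatten_mapP [i]|H i].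
  rewrite mem_iota /= => Hi /mapP [q Hq ->] /=.
  have := H i; rewrite mem_iota /= => /(_ Hi); rewrite IH ?mem_nth // => /allP.
  exact.
rewrite mem_iota /= => Hi; rewrite IH ?mem_nth //; apply/allP => p Hp.
apply: (H (i :: p)); apply/flatten_mapP; exists i; first by rewrite mem_iota.
exact: map_f.
Qed.

Lemma all_innerE Q t : all (fun p => Q (size (children (subt t p)))) (inner t) =
  all (nodeall (fun k => (k == 0) || Q k)) (children t).
Proof.
case: t => s; rewrite /inner all_filter addrsE /=.
rewrite -[in RHS](map_id s) -(map_nth_rtree id) all_map -(map_id (flatten _)) all_map.
apply/allP/allP => /= [H i|H p /flatten_mapP [i]].
  rewrite mem_iota /= => Hi; rewrite nodeallE; apply/allP => p Hp.
  apply: (H (i :: p)); apply/flatten_mapP; exists i; first by rewrite mem_iota.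
  exact: map_f.
rewrite mem_iota /= => Hi /mapP [q Hq ->] /=.
have := H i; rewrite mem_iota /= => /(_ Hi); rewrite nodeallE // => /allP.
exact.
Qed.

(** Numbers of children allowed at a non-root vertex. The root of a state obeys another rule, so
    these conditions are tested on [children t]. *)
Definition degTo (k : nat) := (k == 0) || (2 <= k).
Definition degTbo (k : nat) := (k == 0) || (k == 2).

Lemma in_ToE n t : in_To n t =
  (sumn (map num_leaves (children t)) == n) && all (nodeall degTo) (children t).
Proof. by rewrite /in_To nleavesE (all_innerE (leq 2)). Qed.

Lemma in_TboE n t : in_Tbo n t =
  [&& sumn (map num_leaves (children t)) == n, size (children t) == 1 & all (nodeall degTbo) (children t)].
Proof. by rewrite /in_Tbo nleavesE (all_innerE (eq_op^~ 2)) -andbA. Qed.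

Lemma in_To_canon n t : in_To n (canon t) = in_To n t.
Proof.
rewrite !in_ToE all_children_canon; congr ((_ == _) && _).
by case: t => s /=; apply/perm_sumn/map_canon_eq => x _; apply: num_leaves_canon.
Qed.

Lemma in_Tbo_canon n t : in_Tbo n (canon t) = in_Tbo n t.
Proof.
rewrite !in_TboE all_children_canon size_children_canon; congr ((_ == _) && _).
by case: t => s /=; apply/perm_sumn/map_canon_eq => x _; apply: num_leaves_canon.
Qed.

Lemma nodeall_sub (Q Q' : pred nat) t : subpred Q Q' -> nodeall Q t -> nodeall Q' t.
Proof.
move=> H; elim/rtree_elim: t => s IH /= /andP [/H -> /allP A] /=.
by apply/allP => x xs; apply: IH => //; apply: A.
Qed.

Lemma degTbo_degTo : subpred degTbo degTo. Proof. by move=> k; rewrite /degTbo /degTo; case: k => [|[|[]]]. Qed.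

Lemma in_Tbo_To n t : in_Tbo n t -> in_To n t.
Proof.
rewrite in_TboE in_ToE => /and3P [-> _ /allP H] /=; apply/allP => x /H.
exact/nodeall_sub/degTbo_degTo.
Qed.

(** * Decomposition along paths *)

Definition subforest (D : pred nat) (s : seq rtree) :=
  [seq nth leafT s k | k <- iota 0 (size s) & D k].

Lemma perm_subforest D s : perm_eq s (subforest D s ++ subforest (predC D) s).
Proof.
rewrite /subforest -map_cat -[X in perm_eq X](map_id s) -(map_nth_rtree id).
by apply: perm_map; rewrite perm_sym perm_filterC.
Qed.

Lemma subforest_pred1 i s : i < size s -> subforest (pred1 i) s = [:: nth leafT s i].
Proof. by move=> H; rewrite /subforest filter_pred1_uniq ?iota_uniq ?mem_iota. Qed.

Lemma eq_subforest D D' s : D =1 D' -> subforest D s = subforest D' s.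
Proof. by move=> H; rewrite /subforest (eq_filter H). Qed.

Lemma perm_subforest1 i s : i < size s -> perm_eq s (subforest (predC1 i) s ++ [:: nth leafT s i]).
Proof.
move=> Hi; rewrite -subforest_pred1 //.
rewrite [X in _ ++ X](@eq_subforest _ (predC (predC1 i))); last by move=> k /=; rewrite negbK.
exact: perm_subforest.
Qed.

Definition predC2 i j : pred nat := fun k => (k != i) && (k != j).

Lemma perm_subforest2 i j s : i < size s -> j < size s -> i != j ->
  perm_eq s (subforest (predC2 i j) s ++ [:: nth leafT s i; nth leafT s j]).
Proof.
move=> Hi Hj ij; rewrite (perm_trans (perm_subforest (predC2 i j) s)) // perm_cat2l.
rewrite /subforest -[[:: nth _ _ _; _]]/(map (nth leafT s) [:: i; j]); apply: perm_map.
apply: uniq_perm; rewrite ?filter_uniq ?iota_uniq //= ?inE ?ij // => k.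
rewrite mem_filter mem_iota /= /predC2 negb_and !negbK !inE add0n.
by case: eqVneq => [->|_] /=; [rewrite Hi | case: eqVneq => [->|_]; rewrite ?Hj].
Qed.

Lemma subforest_set_nth i s y : i < size s -> subforest (predC1 i) (set_nth leafT s i y) = subforest (predC1 i) s.
Proof.
move=> Hi; rewrite /subforest size_set_nth (maxn_idPr Hi); apply/eq_in_map => k.
by rewrite mem_filter nth_set_nth /= => /andP [/negPf ->].
Qed.

Lemma perm_set_nth i s y : i < size s ->
  perm_eq (set_nth leafT s i y) (subforest (predC1 i) s ++ [:: y]).
Proof.
move=> Hi; rewrite -(subforest_set_nth y Hi).
have := @perm_subforest1 i (set_nth leafT s i y); rewrite nth_set_nth /= eqxx; apply.
by rewrite size_set_nth (maxn_idPr Hi).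
Qed.

(** The forests left aside at the successive vertices strictly above [w]; [spine_tree] reassembles a
    tree from them and from what stands at [w]. *)
Fixpoint side_trees t (w : addr) : seq (seq rtree) :=
  if w is i :: w' then
    subforest (predC1 i) (children t) :: side_trees (nth leafT (children t) i) w'
  else [::].

Definition spine_tree (hs : seq (seq rtree)) t := foldr (fun h acc => Node (h ++ [:: acc])) t hs.

Lemma spine_tree_cat hs hs' t : spine_tree (hs ++ hs') t = spine_tree hs (spine_tree hs' t).
Proof. exact: foldr_cat. Qed.

Lemma spine_tree_teq hs t u : teq t u -> teq (spine_tree hs t) (spine_tree hs u).
Proof. by elim: hs => //= h hs IH tu; apply: teq_cat => //; apply: IH. Qed.

Lemma replace_spine_tree t w z : valid t w -> teq (replace t w z) (spine_tree (side_trees t w) z).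
Proof.
elim: w t => //= i w IH [s] /= /andP [Hi Hv].
have H := teq_perm (perm_set_nth (replace (nth leafT s i) w z) Hi).
by rewrite /teq H; apply: teq_cat (IH _ Hv) _.
Qed.

Lemma replace_subt t w : valid t w -> replace t w (subt t w) = t.
Proof.
elim: w t => //= i w IH [s] /= /andP [Hi Hv]; rewrite IH //; congr Node.
by apply: (@eq_from_nth _ leafT); rewrite ?size_set_nth ?(maxn_idPr Hi) // => k Hk;
   rewrite nth_set_nth /=; case: eqVneq => // ->.
Qed.

Lemma spine_tree_side_trees t w : valid t w -> teq t (spine_tree (side_trees t w) (subt t w)).
Proof. by move=> H; rewrite -{1}(replace_subt H); apply: replace_spine_tree. Qed.

Lemma subt_replace t w z : valid t w -> subt (replace t w z) w = z.
Proof.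
by elim: w t => //= i w IH [s] /= /andP [Hi Hv]; rewrite nth_set_nth /= eqxx IH.
Qed.

Lemma valid_replace t w z : valid t w -> valid (replace t w z) w.
Proof.
elim: w t => //= i w IH [s] /= /andP [Hi Hv].
by rewrite size_set_nth nth_set_nth /= eqxx IH // leq_max ltnSn.
Qed.

Lemma replace_replace t w z y : valid t w -> replace (replace t w z) w y = replace t w y.
Proof.
elim: w t => //= i w IH [s] /= /andP [Hi Hv].
rewrite nth_set_nth /= eqxx IH //; congr Node.
by rewrite set_set_nth eqxx.
Qed.

Lemma size_children_replace t w z : valid t w -> w != [::] ->
  size (children (replace t w z)) = size (children t).
Proof. by case: w => // i w /= /andP [Hi _] _; rewrite size_set_nth (maxn_idPr Hi). Qed.

(** At each level one follows a child with the same canonical form. Grafting commutes with this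
    change of address, so a leaf inserted in one ordering of a tree can be removed in another. *)
Lemma teq_transport t t' p : teq t t' -> valid t p ->
  exists p', [/\ valid t' p', size p' = size p, teq (subt t p) (subt t' p') &
    forall x y, teq x y -> teq (replace t p x) (replace t' p' y)].
Proof.
elim: p t t' => [|i p IH] [s] [s'] H /=; first by exists [::].
case/andP=> Hi Hv; move/teq_node: (H) => Hp.
have Hin : canon (nth leafT s i) \in map canon s' by rewrite -(perm_mem Hp) map_f ?mem_nth.
case/mapP: Hin => y ys' Ey; have [Hj ny] : index y s' < size s' /\ nth leafT s' (index y s') = y.
  by rewrite index_mem nth_index.
set j := index y s' in Hj ny; rewrite -ny in Ey.
have [p' [V Sz E R]] := IH _ _ Ey Hv.
exists (j :: p'); split => //=; [by rewrite Hj | by rewrite Sz | move=> u v uv].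
have H1 := teq_perm (perm_set_nth (replace (nth leafT s i) p u) Hi).
have H2 := teq_perm (perm_set_nth (replace (nth leafT s' j) p' v) Hj).
rewrite /teq H1 H2; apply/teq_node; rewrite !map_cat /= (R _ _ uv) perm_cat2r.
have D1 := perm_map canon (perm_subforest1 Hi); have D2 := perm_map canon (perm_subforest1 Hj).
rewrite perm_sym in D1; have := perm_trans (perm_trans D1 Hp) D2.
by rewrite !map_cat /= Ey perm_cat2r.
Qed.

Lemma num_leaves_cat1 h t : num_leaves (Node (h ++ [:: t])) = sumn (map num_leaves h) + num_leaves t.
Proof. by rewrite num_leaves_node; [rewrite map_cat sumn_cat /= addn0 | case: h]. Qed.

Lemma num_leaves_spine_tree hs t : num_leaves (spine_tree hs t) = sumn [seq sumn (map num_leaves h) | h <- hs] + num_leaves t.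
Proof.
elim: hs => [|h hs IH] //.
by rewrite -[spine_tree _ _]/(Node (h ++ [:: spine_tree hs t])) num_leaves_cat1 IH /= addnA.
Qed.

Lemma tree_size_spine_tree hs t : tree_size (spine_tree hs t) = sumn [seq (sumn (map tree_size h)).+1 | h <- hs] + tree_size t.
Proof.
elim: hs => //= h hs IH; rewrite map_cat sumn_cat /= IH addn0.
by rewrite -addSn addnA.
Qed.

Lemma num_leaves_replace t w z : valid t w -> num_leaves (replace t w z) + num_leaves (subt t w) = num_leaves t + num_leaves z.
Proof.
move=> V; rewrite (num_leaves_teq (replace_spine_tree z V)) (num_leaves_teq (spine_tree_side_trees V)) !num_leaves_spine_tree.
by rewrite -!addnA; congr (_ + _); rewrite addnC.
Qed.

Lemma tree_size_replace t w z : valid t w -> tree_size (replace t w z) + tree_size (subt t w) = tree_size t + tree_size z.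
Proof.
move=> V; rewrite (tree_size_teq (replace_spine_tree z V)) (tree_size_teq (spine_tree_side_trees V)) !tree_size_spine_tree.
by rewrite -!addnA; congr (_ + _); rewrite addnC.
Qed.

Lemma nodeall_subt Q t p : nodeall Q t -> Q 0 -> nodeall Q (subt t p).
Proof.
move=> + Q0; elim: p t => //= i p IH [s] /= /andP [_ /allP H]; apply: IH.
case: (ltnP i (size s)) => Hi; first by apply: H; rewrite mem_nth.
by rewrite nth_default //= Q0.
Qed.

Lemma nodeall_replace Q t p z : valid t p -> nodeall Q t -> nodeall Q z -> nodeall Q (replace t p z).
Proof.
elim: p t => //= i p IH [s] /= /andP [Hi V] /andP [Qs /allP H] Qz.
rewrite size_set_nth (maxn_idPr Hi) Qs /=; apply/(all_nthP leafT) => k.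
rewrite size_set_nth (maxn_idPr Hi) nth_set_nth /= => Hk.
case: eqVneq => [_|_]; last by apply: H; rewrite mem_nth.
by apply: IH => //; apply: H; rewrite mem_nth.
Qed.

Lemma all_children_replace Q t p z : valid t p -> p != [::] ->
  all (nodeall Q) (children t) -> nodeall Q z -> all (nodeall Q) (children (replace t p z)).
Proof.
case: p => // i p /andP [Hi V] _; case: t Hi V => s /= Hi V /allP H Qz.
apply/(all_nthP leafT) => k; rewrite size_set_nth (maxn_idPr Hi) nth_set_nth /= => Hk.
case: eqVneq => [_|_]; last by apply: H; rewrite mem_nth.
by apply: nodeall_replace => //; apply: H; rewrite mem_nth.
Qed.

Lemma all_children_subt Q t p : all (nodeall Q) (children t) -> Q 0 -> p != [::] ->
  nodeall Q (subt t p).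
Proof.
case: t p => s [//|i p] /= /allP H Q0 _; apply: nodeall_subt => //.
case: (ltnP i (size s)) => Hi; first by apply: H; rewrite mem_nth.
by rewrite nth_default //= Q0.
Qed.

(** Serves only as a witness that every subtree contains a leaf. *)
Fixpoint leftmost_leaf t : addr := let: Node s := t in if s is c :: _ then 0 :: leftmost_leaf c else [::].

Lemma leftmost_leafP t : valid t (leftmost_leaf t) /\ subt t (leftmost_leaf t) = leafT.
Proof.
elim/rtree_elim: t => -[|c s] IH //=; exact: IH (mem_head _ _).
Qed.

(** * Common prefixes and hanging forests *)

Lemma prefix_cat2l (w x y : addr) : prefix (w ++ x) (w ++ y) = prefix x y.
Proof. by rewrite prefix_catr // eqxx. Qed.

Lemma prefix_leq (x y l : addr) : prefix x l -> prefix y l -> size x <= size y -> prefix x y.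
Proof.
rewrite !prefixE => /eqP Ex /eqP Ey H.
by rewrite -Ey take_takel // Ex.
Qed.

Lemma lcpP (x y z : addr) : prefix z (lcp x y) = prefix z x && prefix z y.
Proof.
elim: x y z => [|c x IH] [|d y] [|e z] //=; rewrite ?prefix0s ?andbF //.
case: (eqVneq c d) => [->|cd]; first by rewrite /= IH; case: (e == d).
case: (eqVneq e c) => //= ->.
by rewrite (negPf cd) andbF.
Qed.

Lemma lcp_prefixl (x y : addr) : prefix (lcp x y) x.
Proof. by have := prefix_refl (lcp x y); rewrite lcpP => /andP[]. Qed.
Lemma lcp_prefixr (x y : addr) : prefix (lcp x y) y.
Proof. by have := prefix_refl (lcp x y); rewrite lcpP => /andP[]. Qed.

Lemma size_lcp_lt (x r a : addr) : ~~ prefix x a -> size (lcp (x ++ r) a) < size x.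
Proof.
move=> H; rewrite ltnNge; apply: contra H => H.
apply: prefix_trans (lcp_prefixr (x ++ r) a).
exact: prefix_leq (prefix_prefix _ _) (lcp_prefixl _ _) H.
Qed.

Lemma lcp_at (x q a : addr) k : prefix x a -> ~~ prefix (rcons x k) a ->
  lcp (rcons x k ++ q) a = x.
Proof.
move=> H1 H2; have := size_lcp_lt q H2; rewrite size_rcons ltnS => H.
have P1 : prefix x (lcp (rcons x k ++ q) a).
  by rewrite lcpP H1 andbT cat_rcons prefix_prefix.
have S := size_prefix P1; move/prefixP: P1 => [z E].
move: H; rewrite E size_cat -[X in _ <= X]addn0 leq_add2l leqn0 size_eq0.
by move/eqP->; rewrite cats0.
Qed.

Lemma hangE T a b x : hang T a b x =
  subforest (fun k => ~~ (prefix (rcons x k) a || prefix (rcons x k) b)) (children (subt T x)).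
Proof. by rewrite /hang /subforest; apply: eq_map => k; rewrite -cats1 subt_cat. Qed.

Lemma hangC T a b x : hang T a b x = hang T b a x.
Proof. by rewrite !hangE; apply: eq_subforest => k; rewrite orbC. Qed.

Lemma hang_cat T w a b x : hang T (w ++ a) (w ++ b) (w ++ x) = hang (subt T w) a b x.
Proof. by rewrite !hangE subt_cat; apply: eq_subforest => k; rewrite !rcons_cat !prefix_cat2l. Qed.

Lemma hang_cons T i a b x :
  hang T (i :: a) (i :: b) (i :: x) = hang (nth leafT (children T) i) a b x.
Proof. exact: (hang_cat T [:: i]). Qed.

(** Below the branch point the other leaf excludes no child, so it may be replaced by the first one.
    The computation for a common path then applies with both leaves equal. *)
Lemma hang_diverge T i j a b x : i != j ->
  hang T (i :: a) (j :: b) (i :: x) = hang (nth leafT (children T) i) a a x.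
Proof.
move=> ij; rewrite !hangE; apply: eq_subforest => k.
by rewrite rcons_cons !prefix_cons eqxx (negPf ij) orbF orbb.
Qed.

Lemma hang_nil T i j a b :
  hang T (i :: a) (j :: b) [::] = subforest (predC2 i j) (children T).
Proof.
rewrite !hangE; apply: eq_subforest => k.
by rewrite /= !prefix0s !andbT negb_or.
Qed.

Lemma hang_nil1 T i a b :
  hang T (i :: a) (i :: b) [::] = subforest (predC1 i) (children T).
Proof. by rewrite hang_nil; apply: eq_subforest => k; rewrite /predC2 /= andbb. Qed.

Fixpoint proper_prefixes (w : addr) : seq addr :=
  if w is i :: w' then [::] :: map (cons i) (proper_prefixes w') else [::].

Lemma mem_proper_prefixes x w : (x \in proper_prefixes w) = prefix x w && (x != w).
Proof.
elim: w x => [|i w IH] x; first by rewrite prefixs0; case: x.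
rewrite [proper_prefixes _]/= inE; case: x => [|c x] //=.
rewrite eqseq_cons; case: (eqVneq c i) => [->|ci] /=.
  by rewrite mem_map ?IH // => u v [].
by apply/negbTE/negP => /mapP [y _ [E _]]; rewrite E eqxx in ci.
Qed.

Lemma uniq_proper_prefixes w : uniq (proper_prefixes w).
Proof.
elim: w => // i w IH; rewrite /= map_inj_uniq ?IH ?andbT; last by move=> u v [].
by apply/negP => /mapP [].
Qed.

Lemma map_hang_proper_prefixes T w a b : map (hang T (w ++ a) (w ++ b)) (proper_prefixes w) = side_trees T w.
Proof.
elim: w T => // i w IH T; rewrite /= hang_nil1; congr (_ :: _).
by rewrite -map_comp -IH; apply: eq_map => x /=; rewrite hang_cons.
Qed.


(** * The reduced tree spanned by two leaves *)

Section TwoLeaves.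
Variables (T : rtree) (w a' b' : addr) (i j : nat).
Hypothesis ij : i != j.
Let a := w ++ i :: a'.
Let b := w ++ j :: b'.

Lemma OmegaE : Omega a b = w.
Proof.
rewrite /Omega /a /b; elim: (w) => [|c w' IH] /=; last by rewrite eqxx IH.
by rewrite (negPf ij).
Qed.

Definition points2 := map (fun x => w ++ i :: x) (proper_prefixes a').
Definition points3 := map (fun x => w ++ j :: x) (proper_prefixes b').
(** The vertices of the reduced tree, listed branch by branch, without the two chosen leaves, at
    which nothing hangs. *)
Definition reduced_points := proper_prefixes w ++ w :: points2 ++ points3.

Lemma uniq_R2 : uniq reduced_points.
Proof.
have I c : injective (fun x : addr => w ++ c :: x).
  by move=> u v /eqP; rewrite eqseq_cat // eqxx => /eqP [].
have Nw c : w \notin map (fun x => w ++ c :: x) (proper_prefixes (if c == i then a' else b')).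
  apply/negP => /mapP [x _ /(congr1 size)]; rewrite size_cat /= => /eqP.
  by rewrite -[X in X == _]addn0 eqn_add2l.
have Pw x y : x \in proper_prefixes w -> x != w ++ y.
  rewrite mem_proper_prefixes => /andP [/size_prefix + xw]; apply: contraTneq => E.
  rewrite E size_cat -ltnNge; case: y E => [|c y] E; last by rewrite addnS ltnS leq_addr.
  by rewrite E cats0 eqxx in xw.
have U2 : uniq points2 by rewrite map_inj_uniq ?uniq_proper_prefixes //; apply: I.
have U3 : uniq points3 by rewrite map_inj_uniq ?uniq_proper_prefixes //; apply: I.
rewrite /reduced_points cat_uniq uniq_proper_prefixes /= cat_uniq U2 U3 andbT mem_cat !negb_or.
apply/and3P; split.
- apply/andP; split; first by apply/negP => /(Pw _ [::]); rewrite cats0 eqxx.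
  apply/hasPn => x; rewrite mem_cat => /orP [] /mapP [y _ ->]; apply/negP => H.
    by have := Pw _ (i :: y) H; rewrite eqxx.
  by have := Pw _ (j :: y) H; rewrite eqxx.
- by have := Nw i; have := Nw j; rewrite eqxx eq_sym (negPf ij) => -> ->.
- apply/hasPn => x /mapP [y _ ->]; apply/negP => /mapP [z _ /eqP].
  by rewrite eqseq_cat // eqxx /= eqseq_cons eq_sym (negPf ij).
Qed.

Lemma prefix_cat_cases x c : prefix x (w ++ c) ->
  x \in proper_prefixes w \/ exists2 y, x = w ++ y & prefix y c.
Proof.
rewrite prefixE take_cat; case: ltnP => H /eqP E.
  by left; rewrite mem_proper_prefixes -E prefix_take; apply: contraTneq H => <-; rewrite E ltnn.
right; exists (take (size x - size w) c); rewrite ?prefix_take //.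
Qed.

Lemma mem_R2 x : x \in reduced_points = [&& prefix x a || prefix x b, x != a & x != b].
Proof.
apply/idP/idP => [|/and3P [H xa xb]].
  rewrite /reduced_points mem_cat inE mem_cat => /or3P [|/eqP->|].
  - rewrite mem_proper_prefixes => /andP [H xw]; rewrite (prefix_catl _ H) /=.
    by apply/andP; split; apply/eqP => E; move: (size_prefix H); rewrite E size_cat /= addnS ltnNge leq_addr.
  - by rewrite prefix_prefix /=; apply/andP; split; apply/eqP => /(congr1 size)/eqP;
      rewrite size_cat -[X in X == _]addn0 eqn_add2l.
  - case/orP => /mapP [y]; rewrite mem_proper_prefixes => /andP [H yn] ->; rewrite !prefix_cat2l !prefix_cons !eqxx /= H ?orbT /=;
    rewrite !eqseq_cat // !eqxx /= !eqseq_cons !eqxx (negPf yn) /=; first by rewrite (negPf ij).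
    by rewrite eq_sym (negPf ij).
rewrite /reduced_points mem_cat inE mem_cat; case/orP: H => /prefix_cat_cases [->//|[[|c y] E]];
  rewrite ?E ?cats0 ?eqxx ?orbT // prefix_cons => /andP [/eqP Ec H]; subst c x.
  suff -> : w ++ i :: y \in points2 by rewrite !orbT.
  by apply/mapP; exists y => //; rewrite mem_proper_prefixes H; apply: contraNneq xa => ->.
suff -> : w ++ j :: y \in points3 by rewrite !orbT.
by apply/mapP; exists y => //; rewrite mem_proper_prefixes H; apply: contraNneq xb => ->.
Qed.

Let ca := nth leafT (children (subt T w)) i.
Let cb := nth leafT (children (subt T w)) j.
Let h0 := subforest (predC2 i j) (children (subt T w)).

Lemma hang_w : hang T a b w = h0.
Proof. by rewrite -[X in hang _ _ _ X]cats0 hang_cat hang_nil. Qed.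

Lemma map_hang_P1 : map (hang T a b) (proper_prefixes w) = side_trees T w.
Proof. exact: map_hang_proper_prefixes. Qed.

Lemma map_hang_P2 : map (hang T a b) points2 = side_trees ca a'.
Proof.
rewrite -(map_hang_proper_prefixes _ _ [::] [::]) cats0 -map_comp; apply: eq_map => x /=.
by rewrite hang_cat hang_diverge.
Qed.

Lemma map_hang_P3 : map (hang T a b) points3 = side_trees cb b'.
Proof.
rewrite -(map_hang_proper_prefixes _ _ [::] [::]) cats0 -map_comp; apply: eq_map => x /=.
by rewrite hang_cat hangC hang_diverge // eq_sym.
Qed.

Lemma map_hang_R2 : map (hang T a b) reduced_points = side_trees T w ++ h0 :: side_trees ca a' ++ side_trees cb b'.
Proof. by rewrite map_cat /= map_cat map_hang_P1 hang_w map_hang_P2 map_hang_P3. Qed.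

Hypotheses (la : a \in leaves T) (lb : b \in leaves T).

Lemma leaf_a : subt T a = leafT.
Proof. by move: la; rewrite mem_leaves => /and3P [_ + _]; case: subt => s /= /eqP ->. Qed.
Lemma leaf_b : subt T b = leafT.
Proof. by move: lb; rewrite mem_leaves => /and3P [_ + _]; case: subt => s /= /eqP ->. Qed.
Lemma valid_a : valid T a. Proof. by move: la; rewrite mem_leaves => /and3P []. Qed.
Lemma valid_b : valid T b. Proof. by move: lb; rewrite mem_leaves => /and3P []. Qed.
Lemma valid_w : valid T w. Proof. by move: valid_a; rewrite valid_cat => /andP []. Qed.
Lemma valid_ca : (i < size (children (subt T w))) && valid ca a'.
Proof. by move: valid_a; rewrite valid_cat => /andP [_]. Qed.
Lemma valid_cb : (j < size (children (subt T w))) && valid cb b'.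
Proof. by move: valid_b; rewrite valid_cat => /andP [_]. Qed.

Lemma teq_Omega : teq (subt T w) (Node (h0 ++ [:: spine_tree (side_trees ca a') leafT; spine_tree (side_trees cb b') leafT])).
Proof.
have /andP [Hi Va] := valid_ca; have /andP [Hj Vb] := valid_cb.
have Ea := spine_tree_side_trees Va; have Eb := spine_tree_side_trees Vb.
have := leaf_a; rewrite /a subt_cat /= -/ca => La; rewrite La in Ea.
have := leaf_b; rewrite /b subt_cat /= -/cb => Lb; rewrite Lb in Eb.
have := teq_perm (perm_subforest2 Hi Hj ij); rewrite -/ca -/cb -/h0.
rewrite /teq; case: (subt T w) => s /= ->; apply/teq_node; rewrite !map_cat /=.
by rewrite Ea Eb.
Qed.

Lemma decomp : teq T (spine_tree (side_trees T w) (Node (h0 ++ [:: spine_tree (side_trees ca a') leafT; spine_tree (side_trees cb b') leafT]))).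
Proof. by rewrite /teq (spine_tree_side_trees valid_w); apply/spine_tree_teq/teq_Omega. Qed.

Definition others := [seq l <- leaves T | (l != a) && (l != b)].

(** The leftmost leaf of a tree hanging at [x] leaves the reduced tree at [x], so it projects to
    [x]. *)
Lemma mass_l x : (prefix x a || prefix x b) -> hang T a b x != [::] ->
  x \in map (proj a b) others.
Proof.
move=> Hx; rewrite hangE; set D := (fun k => _) => H.
have [k Hk Dk] : exists2 k, k < size (children (subt T x)) & D k.
  have : has D (iota 0 (size (children (subt T x)))).
    by rewrite has_filter; apply: contraNneq H => E; rewrite /subforest E.
  by case/hasP => k; rewrite mem_iota /=; exists k.
have [V L] := leftmost_leafP (nth leafT (children (subt T x)) k).
set q := leftmost_leaf _ in V L; have Vx : valid T x.
  by case/orP: Hx => /prefixP [z E]; [have := valid_a | have := valid_b]; rewrite E valid_cat => /andP [].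
move: Dk; rewrite /D negb_or => /andP [na nb].
apply/mapP; exists (rcons x k ++ q).
  have E c : ~~ prefix (rcons x k) c -> rcons x k ++ q != c.
    by apply: contraNneq => <-; apply: prefix_prefix.
  rewrite mem_filter !E //= mem_leaves cat_rcons subt_cat /= L eqxx.
  by rewrite valid_cat Vx /= Hk V; case: (x).
rewrite /proj.
have Sb := size_lcp_lt q nb; have Sa := size_lcp_lt q na.
rewrite !size_rcons !ltnS in Sa Sb.
case: (boolP (prefix x a)) => Ha; first by rewrite (lcp_at _ Ha na) Sb.
rewrite (negPf Ha) /= in Hx; rewrite (lcp_at _ Hx nb).
have := size_lcp_lt (k :: q) Ha; rewrite -cat_rcons ltnNge.
by case: ifP => // ->.
Qed.

(** The path to a labelled leaf goes on beyond its projection, and its next child lies on neither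
    chosen path, because the projection is the longest agreement. *)
Lemma mass_r x : x \in map (proj a b) others ->
  (prefix x a || prefix x b) /\ hang T a b x != [::].
Proof.
case/mapP => l; rewrite mem_filter mem_leaves => /andP [/andP [la' lb'] /and3P [_ /eqP Ll Vl]] Ex.
(* The two cases of [proj] are symmetric; [c] is a chosen leaf whose path agrees with that of [l] at
   least as long. *)
suff H c d : valid T c -> l != c -> (size (lcp l d) <= size (lcp l c)) -> hang T c d (lcp l c) != [::].
  move: Ex; rewrite /proj; case: leqP => Hs ->.
    by rewrite lcp_prefixr; split => //; apply: H Hs => //; apply: valid_a.
  by rewrite lcp_prefixr orbT hangC; split => //; apply: H (ltnW Hs) => //; apply: valid_b.
move=> Vc lc Hs; rewrite hangE; move: (lcp_prefixl l c) (lcp_prefixr l c) Hs.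
have Hc := lcpP l c; have Hd := lcpP l d; set x0 := lcp l c in Hc *.
case/prefixP => r El Hxc Hs.
case: r El => [|k q] El.
  rewrite cats0 in El; case/prefixP: Hxc => z Ec.
  move: Vc lc; rewrite Ec -El valid_cat => /andP [_]; case: z {Ec} => [|k z] /=.
    by rewrite cats0 eqxx.
  by rewrite Ll.
set D := (fun k => _); have Dk : D k.
  rewrite /D negb_or; apply/andP; split; apply/negP => Pk.
    have := Hc (rcons x0 k); rewrite Pk El -cat_rcons prefix_prefix => /size_prefix.
    by rewrite size_rcons ltnn.
  have := Hd (rcons x0 k); rewrite Pk El -cat_rcons prefix_prefix cat_rcons -El => /size_prefix.
  by rewrite size_rcons => /leq_trans /(_ Hs); rewrite ltnn.
apply/eqP => /(congr1 size)/eqP; rewrite /subforest size_map size_filter -leqn0 leqNgt -has_count.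
move/hasP; apply; exists k => //; rewrite mem_iota /=.
by move: Vl; rewrite El valid_cat /= => /and3P [].
Qed.

(** Positive mass means a nonempty hanging forest, whatever the labelling: this is why no hanging
    subtree is lost. *)
Lemma perm_points ls : perm_eq ls others ->
  perm_eq (undup (map (proj a b) ls)) [seq x <- reduced_points | hang T a b x != [::]].
Proof.
move=> Hp; apply: uniq_perm; rewrite ?undup_uniq ?filter_uniq ?uniq_R2 // => x.
rewrite mem_undup (perm_mem (perm_map _ Hp)) mem_filter mem_R2.
apply/idP/idP => [/mass_r [-> H]|/andP [H /and3P [Hx _ _]]]; last exact: mass_l.
have E c : subt T c = leafT -> x != c by move=> Ec; apply: contraNneq H => ->; rewrite hangE Ec.
by rewrite H (E _ leaf_a) (E _ leaf_b).
Qed.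

End TwoLeaves.

(** * Cut points and the new spine *)

Definition above (o : option nat) (d : nat) := if o is Some c then c < d else true.

Definition in_block a b (x : addr) (blk : nat * option nat * nat) :=
  let: (i, lo, hi) := blk in
  [&& branch a b x == i, above lo (dist a b x) & dist a b x <= hi].

Lemma block_pointsE a b ys blk : block_points a b ys blk =
  [seq x <- sort (fun x y => dist a b x <= dist a b y) (undup ys) | in_block a b x blk].
Proof.
case: blk => [[i lo] hi]; apply: eq_filter => x; rewrite /in_block /above.
by rewrite andbA; case: lo.
Qed.

Lemma cutsE a b cur y ys : cuts a b cur (y :: ys) =
  if above (cur (branch a b y)) (dist a b y)
  then (branch a b y, cur (branch a b y), dist a b y)
       :: cuts a b (fun k => if k == branch a b y then Some (dist a b y) else cur k) ys
  else cuts a b cur ys.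
Proof. by []. Qed.

Lemma count_cuts a b cur zs x : count (in_block a b x) (cuts a b cur zs) =
  above (cur (branch a b x)) (dist a b x) &&
  has (fun y => (branch a b y == branch a b x) && (dist a b x <= dist a b y)) zs :> nat.
Proof.
elim: zs cur => [|z zs IH] cur; first by rewrite andbF.
rewrite cutsE [has _ _]/=; set dx := dist a b x; set dz := dist a b z.
set hs := has _ zs in IH *.
case: ifP => Hc; rewrite ?[count _ (_ :: _)]/= !IH; last first.
  case: eqVneq => [E|_] //=; rewrite -E; rewrite /above in Hc *.
  case E2: (cur _) Hc => [c|//] /negbT; rewrite -leqNgt => Hc.
  by case: (leqP dx dz) => // H; rewrite ltnNge (leq_trans H Hc).
rewrite (eq_sym (branch a b z)); case: eqVneq => [E|_] //=.
rewrite E -/dx -/dz; move: Hc; set o := cur _; case: (leqP dx dz) => H /=.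
  by rewrite andbT addn0 => _.
rewrite andbF add0n => Hc; suff -> : above o dx by [].
by rewrite /above in Hc *; case: (o) Hc => // c Hc; apply: ltn_trans Hc H.
Qed.

Definition spine_points a b ys := flatten (map (block_points a b ys) (cuts a b (fun=> None) ys)).

(** Starting without cuts, [count_cuts] puts each occurring point in exactly one block, since the
    point itself bounds its distance. *)
Lemma perm_pts a b ys : perm_eq (spine_points a b ys) (undup ys).
Proof.
apply/allP => x _ /=; rewrite /spine_points count_flatten_map.
set U := sort (fun x y => dist a b x <= dist a b y) (undup ys).
have -> : [seq count (pred1 x) (block_points a b ys blk) | blk <- cuts a b (fun=> None) ys]
  = [seq in_block a b x blk * count_mem x (undup ys) | blk <- cuts a b (fun=> None) ys].
  apply: eq_map => blk; rewrite block_pointsE count_filter.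
  rewrite -(permP (permEl (perm_sort (fun x y => dist a b x <= dist a b y) (undup ys)))) -/U.
  case: (boolP (in_block a b x blk)) => H.
    by rewrite mul1n; apply: eq_count => y /=; case: eqVneq => //= ->.
  rewrite mul0n -(count_pred0 U); apply: eq_count => y /=.
  by case: eqVneq => //= ->; apply: negbTE.
have -> L : sumn [seq in_block a b x blk * count_mem x (undup ys) | blk <- L] = count (in_block a b x) L * count_mem x (undup ys).
  by elim: L => //= l L IH; rewrite mulnDl IH.
rewrite count_cuts /=; case: (boolP (x \in ys)) => xs.
  suff -> : has (fun y => (branch a b y == branch a b x) && (dist a b x <= dist a b y)) ys by rewrite mul1n.
  by apply/hasP; exists x; rewrite ?eqxx /=.
by rewrite (count_uniq_mem _ (undup_uniq ys)) mem_undup (negPf xs) muln0.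
Qed.

Lemma undup_nseqs (zs : seq addr) (m : addr -> nat) :
  flatten [seq nseq (m z).+1 z | z <- zs] =i zs.
Proof.
move=> x; apply/flatten_mapP/idP => [[z zz]|xz]; first by rewrite mem_nseq => /eqP ->.
by exists x => //; rewrite mem_nseq eqxx.
Qed.

Lemma cuts_skip a b cur z m ys : above (cur (branch a b z)) (dist a b z) = false ->
  cuts a b cur (nseq m z ++ ys) = cuts a b cur ys.
Proof. by move=> H; elim: m => // m IH; rewrite -[nseq m.+1 z ++ ys]/(z :: (nseq m z ++ ys)) cutsE H. Qed.

(** If labels arrive grouped by projection and outwards along each branch, the first label of each
    group makes a new cut and the repetitions make none. Every block is then a single point, so any
    interleaving of the branches can be realised. *)
Lemma pts_shuffle a b zs m ys : uniq zs ->
  pairwise (fun x y => (branch a b x == branch a b y) ==> (dist a b x < dist a b y)) zs ->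
  ys = flatten [seq nseq (m z).+1 z | z <- zs] -> spine_points a b ys = zs.
Proof.
move=> U Pz Ey; rewrite /spine_points.
have EU : perm_eq (sort (fun x y => dist a b x <= dist a b y) (undup ys)) zs.
  rewrite perm_sort; apply: uniq_perm; rewrite ?undup_uniq // => x.
  by rewrite mem_undup Ey undup_nseqs.
(* Invariant: the points of [zs0] are at or below the current cuts of their branches, those of [zs1]
   still above. *)
suff H zs0 zs1 cur : zs = zs0 ++ zs1 ->
  (forall x, x \in zs1 -> above (cur (branch a b x)) (dist a b x)) ->
  (forall x, x \in zs0 -> above (cur (branch a b x)) (dist a b x) = false) ->
  flatten (map (block_points a b ys) (cuts a b cur (flatten [seq nseq (m z).+1 z | z <- zs1]))) = zs1.
  by rewrite {2}Ey; apply: (H [::]).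
elim: zs1 zs0 cur => [|z zs1 IH] zs0 cur E H1 H0 //.
rewrite -[flatten (map _ (z :: _))]/(z :: (nseq (m z) z ++ flatten [seq nseq (m y).+1 y | y <- zs1])).
rewrite cutsE ifT; last by apply: H1; rewrite mem_head.
rewrite cuts_skip; last by rewrite eqxx /= ltnn.
rewrite map_cons -[flatten (_ :: _)]/(_ ++ flatten (map _ _)).
have Pw : forall x, x \in zs1 -> branch a b z == branch a b x -> dist a b z < dist a b x.
  move=> x xz; apply/implyP; move: Pz; rewrite E pairwise_cat => /and3P [_ _] /=.
  by case/andP => /allP /(_ _ xz).
rewrite (IH (rcons zs0 z)); last 3 first.
- by rewrite E cat_rcons.
- move=> x xz /=; case: eqVneq => [Ex|_]; first by apply: (Pw x xz); rewrite Ex.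
  by apply: H1; rewrite inE xz orbT.
- move=> x /=; rewrite mem_rcons inE => /orP [/eqP ->|xz]; first by rewrite eqxx /= ltnn.
  case: eqP => [Ex|_]; last exact: H0.
  apply/negbTE; rewrite /= -leqNgt leqNgt; apply: contraFN (H0 _ xz) => Hl; rewrite Ex /above.
  have := H1 z (mem_head _ _); rewrite /above; case: (cur _) => // c Hc; exact: ltn_trans Hc Hl.
(* The block ending at [z] contains nothing else: earlier points of its branch were cut off, later
   ones are farther out. *)
rewrite block_pointsE -[RHS]cat1s; congr (_ ++ _).
have Us : uniq (sort (fun x y => dist a b x <= dist a b y) (undup ys)) by rewrite (perm_uniq EU).
have zin : z \in sort (fun x y => dist a b x <= dist a b y) (undup ys).
  by rewrite (perm_mem EU) E mem_cat mem_head orbT.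
rewrite -(filter_pred1_uniq Us zin); apply: eq_in_filter => x; rewrite (perm_mem EU) E mem_cat inE /in_block.
case: (eqVneq x z) => [->|xz] /=; first by rewrite !eqxx leqnn H1 ?mem_head.
rewrite (negPf xz); case/orP => [xz0|xz1].
  by case: eqP => //= <-; rewrite H0.
by case: eqVneq => //= Ex; rewrite [_ <= dist a b z]leqNgt Pw ?andbF // Ex.
Qed.

(** Only the group at the root can be empty, since a later group is opened by a point that does not
    merge. The accumulators [c] and [d] are general for the induction. *)
Lemma groups_general a b c d s : exists g gs,
  [/\ (let: (c', d') := foldl (grp_step a b) (c, d) s in rev (c' :: d')) = rev d ++ (g ++ c) :: gs,
      all (fun g => g != [::]) gs & perm_eq (g ++ flatten gs) s].
Proof.
elim: s c d => [|x s IH] c d; first by exists [::], [::]; rewrite /= rev_cons cats1.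
rewrite [foldl _ _ _]/=; case: (merges a b x).
  have [g [gs [E A Q]]] := IH (x :: c) d; exists (rcons g x), gs.
  by rewrite E cat_rcons; split => //; rewrite cat_rcons -cat1s perm_catCA /= perm_cons.
have [g [gs [E A Q]]] := IH [:: x] (c :: d); exists [::], ((g ++ [:: x]) :: gs).
rewrite E rev_cons cat_rcons; split => //=; first by rewrite A andbT; case: (g).
by rewrite -catA perm_catCA /= perm_cons.
Qed.

Lemma groupsP a b s : exists g gs,
  [/\ groups a b s = g :: gs, all (fun g => g != [::]) gs & perm_eq (g ++ flatten gs) s].
Proof.
have [g [gs [E A Q]]] := groups_general a b [::] [::] s; exists g, gs; split => //.
by rewrite /groups; move: E; rewrite cats0.
Qed.

Lemma groups_exact a b c d s : all (fun x => ~~ merges a b x) s ->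
  (let: (c', d') := foldl (grp_step a b) (c, d) s in rev (c' :: d'))
  = rev d ++ c :: map (fun x => [:: x]) s.
Proof.
elim: s c d => [|x s IH] c d /=; first by rewrite rev_cons cats1.
by case/andP => /negPf -> H; rewrite IH // rev_cons cat_rcons.
Qed.

Lemma spine_singl T a b s : spine T a b (map (fun x => [:: x]) s) = spine_tree (map (hang T a b) s) leafT.
Proof. by elim: s => //= x s ->; rewrite cats0. Qed.

Lemma num_leaves_spine T a b gs :
  num_leaves (spine T a b gs) = (sumn [seq sumn (map num_leaves (hang T a b x)) | x <- flatten gs]).+1.
Proof.
elim: gs => // g gs IH.
rewrite -[spine _ _ _ _]/(Node (flatten (map (hang T a b) g) ++ [:: spine T a b gs])).
rewrite num_leaves_cat1 IH addnS map_cat sumn_cat; congr (_ + _).+1.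
elim: g {IH} => //= x g IH; rewrite map_cat sumn_cat IH //.
Qed.

Lemma nodeall_hang Q T a b x h : all (nodeall Q) (children T) -> Q 0 ->
  h \in hang T a b x -> nodeall Q h.
Proof.
move=> H Q0 /mapP [k _ ->]; apply: all_children_subt => //.
by case: x.
Qed.

(** A spine vertex has its continuation as one child and at least one hanging tree, since its group
    contains a point of positive mass. *)
Lemma nodeall_spine T a b gs : all (nodeall degTo) (children T) ->
  all (fun g => g != [::]) gs -> (forall x, x \in flatten gs -> hang T a b x != [::]) ->
  nodeall degTo (spine T a b gs).
Proof.
move=> HT; elim: gs => // g gs IH /= /andP [g0 A] H.
have Hg x : x \in g -> hang T a b x != [::] by move=> xg; apply: H; rewrite mem_cat xg.
apply/andP; split.
  rewrite size_cat addn1 /degTo /= ltnS; case: g g0 {H} Hg => // x g _ /(_ x (mem_head _ _)).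
  by rewrite /= size_cat -size_eq0; case: size.
rewrite all_cat /= IH ?andbT //; last by move=> x xg; apply: H; rewrite mem_cat xg orbT.
by apply/allP => h /flatten_mapP [x _]; apply: nodeall_hang.
Qed.

Lemma sumn_mass (T : rtree) a b (f : rtree -> nat) s :
  sumn [seq sumn (map f (hang T a b x)) | x <- s & hang T a b x != [::]] =
  sumn [seq sumn (map f h) | h <- map (hang T a b) s].
Proof.
elim: s => //= x s IH; case: eqVneq => [->|_] /=; by rewrite ?IH.
Qed.

Lemma size_subforest1 i s : i < size s -> (size (subforest (predC1 i) s)).+1 = size s.
Proof. by move/perm_subforest1/perm_size => ->; rewrite size_cat addn1. Qed.

Lemma size_subforest2 i j s : i < size s -> j < size s -> i != j -> (size (subforest (predC2 i j) s)).+2 = size s.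
Proof. by move=> Hi Hj ij; rewrite (perm_size (perm_subforest2 Hi Hj ij)) size_cat addn2. Qed.

Lemma side_trees_bin t w : nodeall degTbo t -> valid t w -> all (fun h => size h == 1) (side_trees t w).
Proof.
elim: w t => // i w IH [s] /andP [Qs /allP A] /= /andP [Hi V].
rewrite IH ?andbT //; last by apply: A; rewrite mem_nth.
rewrite -eqSS size_subforest1 //; case/orP: Qs => // /eqP E.
by rewrite E in Hi.
Qed.

Lemma side_trees_To t w : nodeall degTo t -> valid t w -> all (fun h => h != [::]) (side_trees t w).
Proof.
elim: w t => // i w IH [s] /andP [Qs /allP A] /= /andP [Hi V].
rewrite IH ?andbT //; last by apply: A; rewrite mem_nth.
rewrite -size_eq0 -eqSS size_subforest1 //; case/orP: Qs => [/eqP E|]; first by rewrite E in Hi.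
by case: (size s) => [|[]].
Qed.

(** Provides the labelling that lists the leaves by projection, in a prescribed order of the
    points. *)
Lemma perm_fibers (A B : eqType) (f : A -> B) s zs : uniq zs ->
  (forall x, x \in s -> f x \in zs) ->
  perm_eq (flatten [seq [seq l <- s | f l == z] | z <- zs]) s.
Proof.
move=> U H; have {2}<- : [seq l <- s | f l \in zs] = s.
  by apply/all_filterP/allP => x /H.
elim: zs U {H} => [|z zs IH] /=; first by rewrite -(eq_filter (a1 := pred0)) ?filter_pred0.
case/andP => nz U; rewrite perm_sym -(perm_filterC (fun l => f l == z)) -!filter_predI.
rewrite (eq_filter (a2 := fun l => f l == z)); last by move=> x /=; rewrite inE; case: eqVneq.
rewrite perm_cat2l perm_sym (permPl (IH U)).
suff /eq_filter -> : predI (predC (fun l => f l == z)) (fun l => f l \in z :: zs) =1 (fun l => f l \in zs) by [].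
move=> x /=; rewrite inE; by case: eqVneq => //= ->; apply/esym/negbTE.
Qed.

Lemma pairwise_proper_prefixes w : pairwise (fun x y => size x < size y) (proper_prefixes w).
Proof.
elim: w => // i w IH; rewrite /=; apply/andP; split.
  by apply/allP => x /mapP [y _ ->].
by rewrite pairwise_map; apply: sub_pairwise IH.
Qed.

(** * The new tree for a fixed pair of leaves *)

Section TwoLeaves.
Variables (T : rtree) (w a' b' : addr) (i j : nat).
Hypothesis ij : i != j.
Let a := w ++ i :: a'.
Let b := w ++ j :: b'.
Let ca := nth leafT (children (subt T w)) i.
Let cb := nth leafT (children (subt T w)) j.
Let h0 := subforest (predC2 i j) (children (subt T w)).
Hypotheses (la : a \in leaves T) (lb : b \in leaves T).

Lemma branch_P1 x : x \in proper_prefixes w -> branch a b x = 1 /\ dist a b x = size x.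
Proof.
rewrite mem_proper_prefixes => /andP [H xw]; rewrite /branch /dist (OmegaE _ _ _ ij).
suff -> : size x < size w by [].
rewrite ltn_neqAle (size_prefix H) andbT; apply: contraNneq xw => E.
by move: H; rewrite prefixE E take_size eq_sym.
Qed.

Lemma branch_w : branch a b w = 3 /\ dist a b w = 0.
Proof. by rewrite /branch /dist (OmegaE _ _ _ ij) ltnn eqxx subnn. Qed.

Lemma dist_cat c y : dist a b (w ++ c :: y) = (size y).+1.
Proof. by rewrite /dist (OmegaE _ _ _ ij) size_cat /= ltnNge leq_addr /= addKn. Qed.

Lemma branch_P2 x : x \in points2 w a' i -> branch a b x = 2.
Proof.
case/mapP => y; rewrite mem_proper_prefixes => /andP [H _] ->.
rewrite /branch (OmegaE _ _ _ ij) size_cat ltnNge leq_addr /=.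
rewrite -[X in _ == X]cats0 eqseq_cat // eqxx /= /a prefix_cat2l /= eqxx H.
by [].
Qed.

Lemma branch_P3 x : x \in points3 w b' j -> branch a b x = 3.
Proof.
case/mapP => y _ ->.
rewrite /branch (OmegaE _ _ _ ij) size_cat ltnNge leq_addr /=.
rewrite -[X in _ == X]cats0 eqseq_cat // eqxx /= /a prefix_cat2l /= eq_sym (negPf ij).
by [].
Qed.

Lemma dist_P23 x : x \in points2 w a' i ++ points3 w b' j -> 0 < dist a b x.
Proof. by rewrite mem_cat => /orP [] /mapP [y _ ->]; rewrite dist_cat. Qed.

Lemma num_leaves_decomp : num_leaves T = (sumn [seq sumn (map num_leaves h) | h <- map (hang T a b) (reduced_points w a' b' i j)]).+2.
Proof.
rewrite (map_hang_R2 _ _ _ _ ij) (num_leaves_teq (decomp ij la lb)) num_leaves_spine_tree num_leaves_node; last by case: (subforest _ _).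
rewrite map_cat sumn_cat !map_cat !sumn_cat /= !num_leaves_spine_tree addn0 map_cat sumn_cat /=.
by rewrite !addn1 !addSn !addnS.
Qed.

Lemma mem_pts_mass ls x : perm_eq ls (others T w a' b' i j) ->
  x \in spine_points a b (map (proj a b) ls) -> (x \in reduced_points w a' b' i j) && (hang T a b x != [::]).
Proof.
move=> Hp; rewrite (perm_mem (perm_pts _ _ _)) (perm_mem (perm_points ij la lb Hp)).
by rewrite mem_filter andbC.
Qed.

Lemma sumn_pts f ls : perm_eq ls (others T w a' b' i j) ->
  sumn [seq sumn (map f (hang T a b x)) | x <- spine_points a b (map (proj a b) ls)] =
  sumn [seq sumn (map f h) | h <- map (hang T a b) (reduced_points w a' b' i j)].
Proof.
move=> Hp; rewrite -sumn_mass; apply/perm_sumn/perm_map.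
exact: perm_trans (perm_pts _ _ _) (perm_points ij la lb Hp).
Qed.

(** The hanging forests are conserved and the spine ends in one leaf instead of two, so exactly one
    leaf is lost; the degrees come from [nodeall_spine]. *)
Lemma new_tree_To ls : all (nodeall degTo) (children T) -> perm_eq ls (others T w a' b' i j) ->
  in_To (num_leaves T).-1 (new_tree T a b ls).
Proof.
move=> HT Hp; rewrite /new_tree in_To_canon -/(spine_points a b (map (proj a b) ls)).
have [g [gs [E A Q]]] := groupsP a b (spine_points a b (map (proj a b) ls)).
have Hl := num_leaves_spine T a b (groups a b (spine_points a b (map (proj a b) ls))).
rewrite {}E in Hl *; rewrite in_ToE /=; apply/andP; split.
  rewrite num_leaves_node in Hl; last by case: (flatten _).
  rewrite Hl num_leaves_decomp /= -(sumn_pts _ Hp) eqSS; apply/eqP/perm_sumn/perm_map/Q.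
rewrite all_cat /= andbT; apply/andP; split.
  by apply/allP => h /flatten_mapP [x _]; apply: nodeall_hang.
apply: nodeall_spine => // x xg.
have : x \in spine_points a b (map (proj a b) ls) by rewrite -(perm_mem Q) mem_cat xg orbT.
by case/(mem_pts_mass Hp)/andP.
Qed.

(** In a binary tree neither the root nor Omega carries mass, so no point merges, and each other
    point carries exactly one hanging tree. The root group is empty and every spine vertex gets two
    children. *)
Lemma new_tree_Tbo ls n : in_Tbo n T -> perm_eq ls (others T w a' b' i j) ->
  in_Tbo n.-1 (new_tree T a b ls).
Proof.
move=> HT Hp; have := new_tree_To _ Hp.
have lT : num_leaves T = n.
  by move: HT; rewrite in_TboE => /and3P [/eqP <-]; case: (T) => -[].
move: (HT); rewrite in_TboE => /and3P [_ /eqP S1 A] /(_ _) H.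
have {H} := H (introT allP (fun x xs => nodeall_sub degTbo_degTo (allP A x xs))).
rewrite /new_tree in_To_canon in_Tbo_canon -/(spine_points a b (map (proj a b) ls)) in_ToE in_TboE lT.
case/andP => -> _ /=.
set s := spine_points _ _ _.
have Va := valid_a la; have Vb := valid_b lb.
have H1 x : x \in s -> ~~ merges a b x && (size (hang T a b x) == 1).
  move/(mem_pts_mass Hp)/andP => [xR hx].
  have /andP [Hi Vca] := valid_ca la; have /andP [Hj Vcb] := valid_cb lb.
  have w0 : w != [::].
    apply/eqP => E; move: Hi Hj ij; rewrite E /= S1; by case: (i) (j) => [|//] [].
  have Nw : nodeall degTbo (subt T w) by apply: all_children_subt.
  have Sw : size (children (subt T w)) = 2.
    by move: Nw Hi; case: (subt T w) => u /= /andP [/orP [/eqP ->|/eqP ->]].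
  have Nc k : nodeall degTbo (nth leafT (children (subt T w)) k) by exact: (nodeall_subt [:: k]).
  move: xR; rewrite /reduced_points mem_cat inE => /or3P [xP|/eqP xw|xP].
  - have [Bx Dx] := branch_P1 xP.
    rewrite /merges Bx Dx andbT size_eq0.
    have Hmap := map_hang_P1 T w a' b' i j; rewrite -/a -/b in Hmap.
    case: (w) w0 xP Hmap (valid_w la) => // c w' _.
    rewrite [proper_prefixes _]/= inE => xP [E0 E1] /= /andP [Hc Vc].
    have xn : x != [::].
      apply: contraNneq hx => ->; rewrite E0 -size_eq0 -eqSS size_subforest1 // S1.
      by [].
    rewrite (negPf xn) /= in xP; rewrite xn /=.
    have Nc' : nodeall degTbo (nth leafT (children T) c) by apply: (allP A); rewrite mem_nth.
    have := side_trees_bin Nc' Vc; rewrite -E1 all_map => /allP; exact.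
  - have := size_subforest2 Hi Hj ij; rewrite Sw => -[] /eqP; rewrite size_eq0 => /eqP E.
    by move: hx; rewrite xw hang_w // E.
  - rewrite /merges (gtn_eqF (dist_P23 xP)) /=.
    have := side_trees_bin (Nc i) Vca; have := side_trees_bin (Nc j) Vcb.
    rewrite -(map_hang_P2 T w a' b' ij) -(map_hang_P3 T w a' b' ij) -/a -/b.
    have allm l : all (fun h => size h == 1) (map (hang T a b) l) -> x \in l -> size (hang T a b x) == 1.
      by rewrite all_map => /allP H xl; apply: (H x xl).
    by move: xP; rewrite mem_cat => /orP [xP _ /allm H|xP /allm H _]; apply: H.
have -> : groups a b s = [::] :: map (fun x => [:: x]) s.
  by apply: groups_exact; apply/allP => x /H1 /andP [].
rewrite /= andbT spine_singl.
have : forall x, x \in s -> (size (hang T a b x) == 1) && all (nodeall degTbo) (hang T a b x).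
  move=> x /H1 /andP [_ ->]; apply/allP => h; exact: nodeall_hang.
elim: (s) => //= x s' IH H; have /andP [/eqP E Ah] := H x (mem_head _ _).
rewrite size_cat E all_cat Ah /= IH //.
by move=> y ys; apply: H; rewrite inE ys orbT.
Qed.

(** Labels are ordered by projection: Omega if it has mass, then the rest of branches 1, 2 and 3.
    Being met at the beginning, Omega merges with the root, and the remaining points form a single
    spine. The condition on [w] ensures that the root has no mass unless it is Omega. *)
Lemma new_tree_key : all (nodeall degTo) (children T) ->
  (w == [::]) || (size (children T) == 1) ->
  exists2 ls, perm_eq ls (others T w a' b' i j) &
  new_tree T a b ls =
    canon (Node (h0 ++ [:: spine_tree (behead (side_trees T w) ++ side_trees ca a' ++ side_trees cb b') leafT])).
Proof.
move=> A Hw.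
have /andP [Hi Vca] := valid_ca la; have /andP [Hj Vcb] := valid_cb lb.
pose nm := behead (proper_prefixes w) ++ points2 w a' i ++ points3 w b' j.
have Enm : map (hang T a b) nm = behead (side_trees T w) ++ side_trees ca a' ++ side_trees cb b'.
  by rewrite !map_cat -behead_map map_hang_P1 (map_hang_P2 T w a' b' ij) (map_hang_P3 T w a' b' ij).
(* Omega is listed only when something hangs there; otherwise no label projects to it. *)
pose zw := if h0 == [::] then [::] else [:: w].
pose zs := zw ++ nm.
have Nc k : nodeall degTo (nth leafT (children (subt T w)) k).
  rewrite -[nth _ _ _]/(subt (subt T w) [:: k]) -subt_cat.
  by apply: all_children_subt => //; rewrite -size_eq0 size_cat addn1.
have Hnm : all (fun x => hang T a b x != [::]) nm.
  rewrite -(all_map (hang T a b) (fun h => h != [::])) Enm !all_cat (side_trees_To (Nc i) Vca) (side_trees_To (Nc j) Vcb) !andbT.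
  case: (w) (valid_w la) => //= c w' /andP [Hc Vc]; apply: side_trees_To => //.
  by apply: (allP A); rewrite mem_nth.
have Hz : perm_eq [seq x <- reduced_points w a' b' i j | hang T a b x != [::]] zs.
  rewrite filter_cat /= hang_w // -/h0 filter_cat.
  rewrite (_ : [seq x <- proper_prefixes w | hang T a b x != [::]] = behead (proper_prefixes w)); last first.
    have := map_hang_P1 T w a' b' i j; rewrite -/a -/b.
    move: Hnm; rewrite /nm; case: (w) (valid_w la) Hw => // c w' /andP [Hc _] /eqP S1.
    rewrite /= all_cat => /andP [/all_filterP -> _] [-> _].
    by rewrite -size_eq0 -eqSS size_subforest1 // S1 eqxx.
  rewrite -filter_cat (_ : [seq x <- points2 w a' i ++ points3 w b' j | _] = points2 w a' i ++ points3 w b' j); last first.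
    by apply/all_filterP; move: Hnm; rewrite /nm all_cat => /andP [].
  rewrite /zs /zw /nm; case: (h0 == [::]) => //=.
  by rewrite -cat1s perm_catCA.
have Uz : uniq zs by rewrite -(perm_uniq Hz) filter_uniq ?uniq_R2.
have Hm x : x \in map (proj a b) (others T w a' b' i j) -> x \in zs.
  rewrite -(perm_mem Hz) -mem_undup.
  by rewrite (perm_mem (perm_points ij la lb (perm_refl _))).
pose ls := flatten [seq [seq l <- others T w a' b' i j | proj a b l == z] | z <- zs].
have Pls : perm_eq ls (others T w a' b' i j).
  by apply: perm_fibers => // x xs; apply/Hm/map_f.
exists ls => //.
(* The multiplicity is shifted by one: each listed point is the projection of at least one label. *)
pose m z := (count (fun l => proj a b l == z) (others T w a' b' i j)).-1.
have Eys : map (proj a b) ls = flatten [seq nseq (m z).+1 z | z <- zs].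
  rewrite map_flatten -map_comp; congr flatten; apply/eq_in_map => z zz /=.
  have zin : z \in map (proj a b) (others T w a' b' i j).
    by rewrite -mem_undup (perm_mem (perm_points ij la lb (perm_refl _))) (perm_mem Hz).
  rewrite -[RHS]/(nseq (m z).+1 z) /m prednK; last first.
    by rewrite -has_count; case/mapP: zin => l lo ->; apply/hasP; exists l.
  rewrite -size_filter; elim: (others _ _ _ _ _ _) => //= l o IH.
  by case: eqP => //= ->; rewrite IH.
have Es : spine_points a b (map (proj a b) ls) = zs.
  apply: pts_shuffle Eys => //.
  pose lt x y := (branch a b x == branch a b y) ==> (dist a b x < dist a b y).
  have B1 x : x \in behead (proper_prefixes w) -> branch a b x = 1 /\ dist a b x = size x.
    by move=> /mem_behead; apply: branch_P1.
  have [Bw Dw] := branch_w.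
  rewrite -/lt !pairwise_cat; apply/and5P; split.
  - apply/allrelP => x y; rewrite /zw; case: ifP => // _; rewrite inE => /eqP ->.
    rewrite mem_cat /lt Bw Dw => /orP [/B1 [-> _]//|yP].
    by rewrite dist_P23 ?implybT.
  - by rewrite /zw; case: ifP.
  - apply/allrelP => x y /B1 [Bx _]; rewrite mem_cat /lt Bx.
    by case/orP => [/branch_P2|/branch_P3] ->.
  - have : pairwise (fun x y => size x < size y) (behead (proper_prefixes w)).
      by have := pairwise_proper_prefixes w; case: (proper_prefixes w) => //= x s /andP [].
    apply: (sub_in_pairwise (P := [in behead (proper_prefixes w)])); last by apply/allP.
    by move=> x y /B1 [_ Dx] /B1 [_ Dy]; rewrite /lt Dx Dy => ->; rewrite implybT.
  - apply/and3P; split.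
    + by apply/allrelP => x y /branch_P2 Bx /branch_P3 By; rewrite /lt Bx By.
    + rewrite /points2 pairwise_map; apply: sub_pairwise (pairwise_proper_prefixes a') => x y H /=.
      by rewrite /lt !dist_cat ltnS H implybT.
    + rewrite /points3 pairwise_map; apply: sub_pairwise (pairwise_proper_prefixes b') => x y H /=.
      by rewrite /lt !dist_cat ltnS H implybT.
rewrite /new_tree -/(spine_points a b (map (proj a b) ls)) Es; congr canon.
have Nm : all (fun x => ~~ merges a b x) nm.
  apply/allP => x; rewrite mem_cat /merges => /orP [xP|/dist_P23]; last by case: (dist a b x).
  have [_ ->] := branch_P1 (mem_behead xP).
  by case: (w) xP => // c w' => /= /mapP [y _ ->].
rewrite /zs /zw; case: eqVneq => [E0|_]; rewrite /groups /=.
  by have := groups_exact [::] [::] Nm; case: (foldl _ _ _) => c d ->; rewrite /= spine_singl Enm E0.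
have [Bw Dw] := branch_w; rewrite {1}/merges Dw Bw /=.
have := groups_exact [:: w] [::] Nm; case: (foldl _ _ _) => c d -> /=.
by rewrite spine_singl Enm cats0 hang_w.
Qed.
End TwoLeaves.

(** * The transition kernel *)

Lemma addrs_uniq t : uniq (addrs t).
Proof.
elim/rtree_elim: t => s IH; rewrite addrsE /=; apply/andP; split.
  by apply/negP => /flatten_mapP [i _ /mapP []].
apply: allpairs_uniq_dep; first exact: iota_uniq.
  by move=> i; rewrite mem_iota /= => Hi; apply: IH; rewrite mem_nth.
by move=> [x y] [x' y'] _ _ /= [-> ->].
Qed.

Lemma leaves_uniq t : uniq (leaves t).
Proof. exact/filter_uniq/addrs_uniq. Qed.

Lemma forestsS fuel k : forests fuel.+1 k.+1 =
  flatten [seq [seq Node f :: g | f <- forests fuel a.-1, g <- forests fuel (k.+1 - a)]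
          | a <- iota 1 k.+1].
Proof. by []. Qed.

Lemma mem_forests fuel k s : k < fuel -> sumn (map tree_size s) = k -> s \in forests fuel k.
Proof.
elim: fuel k s => // fuel IH k [|[f] s] Hk Ek; first by rewrite -Ek /= inE.
move: Ek; rewrite [sumn _]/= addSn; set x := sumn (map tree_size f); set y := sumn (map tree_size s) => Ek.
rewrite -{k}Ek in Hk *; rewrite forestsS.
have Hx : x < fuel by rewrite -ltnS (leq_trans _ Hk) // !ltnS leq_addr.
have Hy : y < fuel by rewrite -ltnS (leq_trans _ Hk) // !ltnS leq_addl.
apply/flatten_mapP; exists x.+1; first by rewrite mem_iota add1n !ltnS leq_addr.
apply/allpairsP; exists (f, s); split => //; first exact: IH.
by rewrite subSS addKn; apply: IH.
Qed.

(** Without vertices of a single child there are fewer inner vertices than leaves. The forest form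
    gains one for each tree, and this gain of at least two pays for the parent in the induction. *)
Lemma tree_size_To s : all (nodeall degTo) s ->
  sumn (map tree_size s) + size s <= 2 * sumn (map num_leaves s).
Proof.
suff H t : nodeall degTo t -> tree_size t < 2 * num_leaves t.
  by elim: s => //= t s IH /andP [/H Ht /IH Hs]; rewrite -[(size s).+1]add1n mulnDr addnACA leq_add // addn1.
elim/rtree_elim: t => s0 IH; case: (eqVneq s0 [::]) => [->//|s0n].
rewrite num_leaves_node //= => /andP [Q A].
have {IH A} : sumn (map tree_size s0) + size s0 <= 2 * sumn (map num_leaves s0).
  elim: s0 {s0n Q} IH A => //= t s1 IHs IH /andP [At As]; rewrite -[(size s1).+1]add1n mulnDr addnACA leq_add //.
    by rewrite addn1 IH ?mem_head.
  by apply: IHs => // x xs; apply: IH; rewrite inE xs orbT.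
apply: leq_trans; case/orP: Q => [|Q]; first by rewrite size_eq0 (negPf s0n).
by rewrite -addn2 leq_add2l.
Qed.

Lemma in_To_nonleaf n t : 0 < n -> in_To n t -> children t != [::] /\ num_leaves t = n.
Proof.
move=> n0; rewrite in_ToE => /andP [/eqP E _]; case: t E => -[|x s] /= E.
  by rewrite -E in n0.
by [].
Qed.

Lemma tree_size_le n t : 0 < n -> in_To n t -> tree_size t <= 2 * n.
Proof.
move=> n0 H; have [cn _] := in_To_nonleaf n0 H; move: H; rewrite in_ToE => /andP [/eqP <- A].
case: t cn A => s /= sn /tree_size_To; apply: leq_trans.
by rewrite -addn1 leq_add2l lt0n size_eq0.
Qed.

Lemma mem_state_list n t : 0 < n -> (t \in state_list n) = is_state n t.
Proof.
move=> n0; rewrite mem_filter andb_idr // => /andP [_ /(tree_size_le n0) H].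
case: t H => s /= H; apply/flatten_mapP; exists (sumn (map tree_size s)); first by rewrite mem_iota.
by apply: map_f; apply: mem_forests.
Qed.

Lemma diverge (a b : addr) : ~~ prefix a b -> ~~ prefix b a ->
  exists w i j a' b', [/\ i != j, a = w ++ i :: a' & b = w ++ j :: b'].
Proof.
elim: a b => [|x a IH] [|y b] //=; rewrite (eq_sym y).
case: (eqVneq x y) => [->|xy] /=; last by exists [::], x, y, a, b.
move=> H1 H2; have [w [i [j [a' [b' [ij -> ->]]]]]] := IH _ H1 H2.
by exists (y :: w), i, j, a', b'.
Qed.

(** Neither of two distinct leaves is an ancestor of the other; this brings any pair into the normal
    form of the two-leaf sections. *)
Lemma leaves_diverge T a b : a \in leaves T -> b \in leaves T -> a != b ->
  exists w i j a' b', [/\ i != j, a = w ++ i :: a' & b = w ++ j :: b'].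
Proof.
have N x y : x \in leaves T -> y \in leaves T -> x != y -> ~~ prefix x y.
  rewrite !mem_leaves => /and3P [_ /eqP L _] /and3P [_ _ V]; apply: contraNN.
  move/prefixP => [z E]; move: V; rewrite E valid_cat => /andP [_].
  by case: z E => [|k z] E; rewrite ?cats0 ?eqxx //= L.
by move=> la lb ab; apply: diverge; apply: N => //; rewrite eq_sym.
Qed.

(** * Insertion of a leaf and the support of the kernel *)

Section Insert.
Variables (T : rtree) (v : addr).
Hypothesis Hv : v \in edges T.

Lemma valid_edge : valid T v. Proof. by move: Hv; rewrite mem_edges => /andP []. Qed.
Lemma edge_nil : v != [::]. Proof. by move: Hv; rewrite mem_edges => /andP []. Qed.

Lemma num_leaves_insert : num_leaves (insert_leaf T v) = (num_leaves T).+1.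
Proof.
apply/eqP; rewrite -(eqn_add2r (num_leaves (subt T v))) num_leaves_replace ?valid_edge //=.
by rewrite addn0 addn1 addnS addSn.
Qed.

Lemma tree_size_insert : tree_size (insert_leaf T v) = (tree_size T).+2.
Proof.
apply/eqP; rewrite -(eqn_add2r (tree_size (subt T v))) tree_size_replace ?valid_edge //=.
by rewrite addn1 !addnS !addSn.
Qed.

Lemma size_children_insert : size (children (insert_leaf T v)) = size (children T).
Proof. by rewrite size_children_replace ?valid_edge ?edge_nil. Qed.

Lemma all_insert (Q : pred nat) : Q 0 -> Q 2 -> all (nodeall Q) (children T) ->
  all (nodeall Q) (children (insert_leaf T v)).
Proof.
move=> Q0 Q2 A; apply: all_children_replace; rewrite ?valid_edge ?edge_nil //=.
by rewrite Q0 Q2 all_children_subt ?edge_nil.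
Qed.
End Insert.

(** The support of the kernel, with the random choices as existential witnesses; [trans_prob_gt0]
    makes the link. *)
Definition can_step T T' := exists v a b ls,
  let T1 := insert_leaf T v in
  [/\ v \in edges T, (a \in leaves T1) && (b \in leaves T1), a != b,
      perm_eq ls [seq l <- leaves T1 | (l != a) && (l != b)] & new_tree T1 a b ls = T'].

Lemma canon_new_tree T a b ls : canon (new_tree T a b ls) = new_tree T a b ls.
Proof. exact: canon_id. Qed.

Lemma step_state n T T' : 0 < n -> in_To n T -> can_step T T' -> is_state n T'.
Proof.
move=> n0 HT [v [a [b [ls [Hv /andP [la lb] ab Hp <-]]]]].
rewrite /is_state canon_new_tree eqxx /=.
have [w [i [j [a' [b' [ij Ea Eb]]]]]] := leaves_diverge la lb ab; subst a b.
have [_ Ln] := in_To_nonleaf n0 HT.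
have := new_tree_To ij la lb _ Hp; rewrite num_leaves_insert // Ln /=; apply.
by apply: all_insert => //; move: HT; rewrite in_ToE => /andP [].
Qed.

Lemma insert_Tbo n T v : 0 < n -> in_Tbo n T -> v \in edges T -> in_Tbo n.+1 (insert_leaf T v).
Proof.
move=> n0 HT Hv; have [_ Ln] := in_To_nonleaf n0 (in_Tbo_To HT).
move: HT; rewrite !in_TboE size_children_insert // => /and3P [_ -> A].
rewrite all_insert // !andbT; apply/eqP; rewrite -Ln -(num_leaves_insert Hv).
by have := size_children_insert Hv; case: (insert_leaf T v) => -[|//]; case: (T) Hv => -[].
Qed.

Lemma step_Tbo n T T' : 0 < n -> in_Tbo n T -> can_step T T' -> in_Tbo n T'.
Proof.
move=> n0 HT [v [a [b [ls [Hv /andP [la lb] ab Hp <-]]]]].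
have [w [i [j [a' [b' [ij Ea Eb]]]]]] := leaves_diverge la lb ab; subst a b.
exact: (new_tree_Tbo ij la lb (insert_Tbo n0 HT Hv) Hp).
Qed.

(** * Averages: positivity and total mass *)

Section Avg.
Local Open Scope ring_scope.
Variable (R : numFieldType).

Lemma avg_ge0 (X : eqType) (s : seq X) (f : X -> R) :
  (forall x, x \in s -> 0 <= f x) -> 0 <= avg s f.
Proof. by move=> H; rewrite /avg divr_ge0 ?ler0n // big_seq sumr_ge0. Qed.

Lemma avg_gt0 (X : eqType) (s : seq X) (f : X -> R) x0 :
  (forall x, x \in s -> 0 <= f x) -> x0 \in s -> 0 < f x0 -> 0 < avg s f.
Proof.
move=> H xs fx; rewrite /avg divr_gt0 //; last by rewrite ltr0n; case: s {H} xs.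
rewrite (big_rem x0) //= ltr_wpDr // big_seq sumr_ge0 // => x /mem_rem; exact: H.
Qed.

Lemma avg_gt0_ex (X : eqType) (s : seq X) (f : X -> R) :
  (forall x, x \in s -> 0 <= f x) -> 0 < avg s f -> exists2 x, x \in s & 0 < f x.
Proof.
move=> H H1; have : has (fun x => 0 < f x) s; last by case/hasP => x xs fx; exists x.
apply: contraTT H1 => /hasPn N; rewrite /avg big_seq big1 ?mul0r ?ltxx // => x xs.
by apply/eqP; have := N _ xs; rewrite lt_neqAle H // andbT negbK eq_sym.
Qed.

Lemma avg_const (X : eqType) (s : seq X) (f : X -> R) c :
  s != [::] -> (forall x, x \in s -> f x = c) -> avg s f = c.
Proof.
move=> s0 H; rewrite /avg big_seq (eq_bigr (fun=> c)) // -big_seq big_const_seq count_predT iter_addr_0.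
by rewrite -(mulr_natr c) mulfK // pnatr_eq0 size_eq0.
Qed.

Lemma sum_avg (I : finType) (X : eqType) (s : seq X) (f : I -> X -> R) :
  \sum_t avg s (f t) = avg s (fun x => \sum_t f t x).
Proof. by rewrite /avg -mulr_suml exchange_big. Qed.

End Avg.

Section TransProb.
Local Open Scope ring_scope.
Variable (R : numFieldType).

Lemma trans_prob_ge0 T T' : 0 <= @trans_prob R T T'.
Proof. by do 3! (apply: avg_ge0 => ? _). Qed.

Lemma trans_prob_gt0 T T' : (0 < @trans_prob R T T') <-> can_step T T'.
Proof.
split.
  move/avg_gt0_ex => [v _|v Hv]; first by do 2! (apply: avg_ge0 => ? _).
  move/avg_gt0_ex => [ab _|[a b]]; first by apply: avg_ge0 => ? _.
  case/allpairsPdep => x [y [xL]]; rewrite mem_filter => /andP [yx yL] [-> ->] {a b}.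
  move/avg_gt0_ex => [ls _//|ls]; rewrite mem_permutations => Hp.
  rewrite ltr0n lt0b => /eqP E; exists v, x, y, ls; split => //; last by rewrite eq_sym.
  by rewrite xL.
move=> [v [a [b [ls [Hv /andP [la lb] ab Hp E]]]]].
apply: (avg_gt0 (x0 := v)) => //; first by move=> ? _; do 2! (apply: avg_ge0 => ? _).
apply: (avg_gt0 (x0 := (a, b))) => //; first by move=> ? _; apply: avg_ge0 => ? _.
  by apply/allpairsPdep; exists a, b; rewrite mem_filter eq_sym ab.
apply: (avg_gt0 (x0 := ls)) => //=; first by rewrite mem_permutations.
by rewrite E eqxx ltr01.
Qed.

(** Two things to check: every averaged list is nonempty (an empty average would be 0), and every
    outcome is a state, so it contributes to exactly one term. *)
Lemma trans_prob_sum n T : (2 <= n)%N -> in_To n T ->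
  \sum_(t : state n) @trans_prob R T (ssval t) = 1.
Proof.
move=> n2 HT; have n0 : (0 < n)%N by apply: leq_trans n2.
have [cn Ln] := in_To_nonleaf n0 HT.
rewrite sum_avg; apply: avg_const.
  apply/eqP => E; have := mem_edges T [:: 0%N]; rewrite E /=.
  by case: (T) cn => -[].
move=> v Hv; rewrite sum_avg; apply: avg_const.
  have : (1 < size (leaves (insert_leaf T v)))%N.
    rewrite -[size _]/(nleaves _) nleavesE.
    have := num_leaves_insert Hv; rewrite Ln; have := size_children_insert Hv.
    case: (insert_leaf T v) => -[|x s] /= Es; last by move=> ->; rewrite ltnS.
    by case: (T) cn Es => -[].
  have := leaves_uniq (insert_leaf T v); case: (leaves _) => [|x [|y s]] //.
  rewrite [uniq _]/= inE negb_or -andbA => /andP [xy _] _.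
  set L := [seq _ | _ <- _, _ <- _]; suff : (x, y) \in L by case: L.
  by apply/allpairsPdep; exists x, y; rewrite mem_filter !inE !eqxx (eq_sym y x) xy orbT.
move=> [a b] /allpairsPdep [x [y [xL]]]; rewrite mem_filter => /andP [yx yL] [-> ->].
rewrite sum_avg; apply: avg_const.
  by apply/eqP => E; have := mem_permutations [seq l <- leaves (insert_leaf T v) | (l != x) && (l != y)] [seq l <- leaves (insert_leaf T v) | (l != x) && (l != y)]; rewrite E perm_refl.
move=> ls; rewrite mem_permutations /= => Hp.
have St : new_tree (insert_leaf T v) x y ls \in state_list n.
  rewrite mem_state_list //; apply: step_state HT _ => //.
  by exists v, x, y, ls; split; rewrite ?xL ?yL 1?eq_sym.
rewrite (bigD1 (SeqSub St)) //= eqxx big1 ?addr0 // => t Ht.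
case: eqVneq => // E; case/eqP: Ht; apply: val_inj; by rewrite /= -E.
Qed.
End TransProb.

(** * Leaf moves and progress towards binary trees *)

Lemma mem_leaves_cons T w i a' : valid T (w ++ i :: a') -> subt T (w ++ i :: a') = leafT ->
  w ++ i :: a' \in leaves T.
Proof. by move=> V L; rewrite mem_leaves L V; case: (w). Qed.

Lemma step_key n T v w i j a' b' : let T1 := insert_leaf T v in
  0 < n -> in_To n T -> v \in edges T -> i != j ->
  w ++ i :: a' \in leaves T1 -> w ++ j :: b' \in leaves T1 ->
  (w == [::]) || (size (children T) == 1) ->
  can_step T (canon (Node (subforest (predC2 i j) (children (subt T1 w)) ++
    [:: spine_tree (behead (side_trees T1 w) ++ side_trees (nth leafT (children (subt T1 w)) i) a'
            ++ side_trees (nth leafT (children (subt T1 w)) j) b') leafT]))).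
Proof.
move=> T1 n0 HT Hv ij la lb Hw.
have A : all (nodeall degTo) (children T1).
  by apply: all_insert => //; move: HT; rewrite in_ToE => /andP [].
have [|ls Hp E] := new_tree_key ij la lb A; first by rewrite size_children_insert.
exists v, (w ++ i :: a'), (w ++ j :: b'), ls; split => //; first exact/andP.
by rewrite eqseq_cat // eqxx /= eqseq_cons (negPf ij).
Qed.

Lemma side_trees_root1 T w : size (children T) = 1 -> w != [::] -> valid T w ->
  side_trees T w = [::] :: behead (side_trees T w).
Proof.
case: w => //= i w S1 _ /andP [Hi _]; congr (_ :: _); apply/eqP.
by rewrite -size_eq0 -eqSS size_subforest1 // S1.
Qed.

(* The killed leaf is the whole third branch, and Omega carries no mass. *)
Lemma step_del n T v w c : 0 < n -> in_Tbo n T -> v \in edges T ->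
  valid (insert_leaf T v) w -> w != [::] ->
  teq (subt (insert_leaf T v) w) (Node [:: c; leafT]) ->
  can_step T (canon (replace (insert_leaf T v) w c)).
Proof.
set T1 := insert_leaf T v => n0 HT Hv Vw w0 Ec.
have S1 : size (children T) = 1 by move: HT; rewrite in_TboE => /and3P [_ /eqP].
have [x [y [Es Hxy]]] : exists x y, subt T1 w = Node [:: x; y] /\
    ((teq x c /\ y = leafT) \/ (teq y c /\ x = leafT)).
  move: Ec; case: (subt T1 w) => s /teq_node Hp.
  have := perm_size Hp; rewrite size_map; case: s Hp => [|x [|y []]] // Hp _.
  exists x, y; split => //; move: Hp => /= Hp.
  have : leafT \in [:: canon x; canon y] by rewrite (perm_mem Hp) !inE eqxx orbT.
  rewrite !inE => /orP [] /eqP E.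
    right; split; last by apply: teq_leaf; rewrite /teq -E.
    have H2 : perm_eq [:: leafT; canon y] [:: leafT; canon c].
      rewrite {1}E; apply: perm_trans Hp _; exact: (permEl (perm_catC [:: canon c] [:: leafT])).
    by move: H2; rewrite perm_cons => /(perm_mem)/(_ (canon y)); rewrite !inE eqxx => /esym/eqP.
  left; split; last by apply: teq_leaf; rewrite /teq -E.
  have H2 : perm_eq [:: leafT; canon x] [:: leafT; canon c].
    rewrite {1}E; apply: perm_trans (permEl (perm_catC [:: canon y] [:: canon x])) _.
    apply: perm_trans Hp _; exact: (permEl (perm_catC [:: canon c] [:: leafT])).
  by move: H2; rewrite perm_cons => /(perm_mem)/(_ (canon x)); rewrite !inE eqxx => /esym/eqP.
have [i [j [ij [Hi Hj [Ei Ej]]]]] : exists i j, i != j /\ [/\ i < 2, j < 2 &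
    teq (nth leafT [:: x; y] i) c /\ nth leafT [:: x; y] j = leafT].
  by case: Hxy => -[]; [exists 0, 1 | exists 1, 0].
set ca := nth leafT [:: x; y] i in Ei *.
(* Any leaf below [ca] can serve as Sigma_1: the path to it is taken apart and rebuilt unchanged. *)
have [Va La] := leftmost_leafP ca.
have la : w ++ i :: leftmost_leaf ca \in leaves T1.
  by apply: mem_leaves_cons; rewrite ?valid_cat ?subt_cat Es /= -/ca ?Vw ?Hi.
have lb : w ++ j :: [::] \in leaves T1.
  by apply: mem_leaves_cons; rewrite ?valid_cat ?subt_cat Es /= ?Ej ?Vw ?Hj.
have := step_key n0 (in_Tbo_To HT) Hv ij la lb; rewrite -/T1 Es [children _]/= -/ca S1 orbT => /(_ isT).
have -> : subforest (predC2 i j) [:: x; y] = [::].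
  by apply: size0nil; apply/eqP; rewrite -2!eqSS size_subforest2.
rewrite [side_trees _ [::]]/= cats0; congr (can_step T _).
rewrite -[RHS]/(canon _) (replace_spine_tree c Vw) (side_trees_root1 _ w0 Vw) ?size_children_insert //.
have E : teq c (spine_tree (side_trees ca (leftmost_leaf ca)) leafT) by rewrite /teq -Ei (spine_tree_side_trees Va) La.
rewrite (spine_tree_teq (_ :: _) E) -spine_tree_cat //.
Qed.

(** The common extension contains, next to the subtree of [S] at [v'], a leaf whose removal leaves
    [S]. The step inserts at [v] and kills that leaf by [step_del], after transport of its
    address. *)
Lemma step_leaf_move n T S v v' : 0 < n -> in_Tbo n T -> v \in edges T -> v' \in edges S ->
  teq (insert_leaf T v) (insert_leaf S v') -> can_step T (canon S).
Proof.
move=> n0 HT Hv Hv' E.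
have Vv' := valid_edge Hv'.
have Vi : valid (insert_leaf S v') v' by apply: valid_replace.
have [w [Vw Sw Es R]] := teq_transport (esym E) Vi.
have w0 : w != [::] by rewrite -size_eq0 Sw size_eq0 (edge_nil Hv').
rewrite subt_replace // in Es.
have := step_del n0 HT Hv Vw w0 (esym Es).
by rewrite -(R _ _ (erefl (canon (subt S v')))) replace_replace // replace_subt.
Qed.

(** Meant for the tree above the root edge of a binary state, so the empty address is allowed: it
    stands for the root edge. *)
Definition leaf_move t s := exists p q,
  [/\ valid t p, valid s q & teq (insert_leaf t p) (insert_leaf s q)].

Inductive move_connected : rtree -> rtree -> Prop :=
| move_connected_refl t s : teq t s -> move_connected t s
| move_connected_step t u s : leaf_move t u -> nodeall degTbo u -> move_connected u s -> move_connected t s.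

Lemma leaf_move_sym t s : leaf_move t s -> leaf_move s t.
Proof. by move=> [p [q [Vp Vq E]]]; exists q, p. Qed.

Lemma leaf_move_teql t t' s : teq t t' -> leaf_move t s -> leaf_move t' s.
Proof.
move=> E [p [q [Vp Vq H]]]; have [p' [Vp' _ Ep R]] := teq_transport E Vp.
exists p', q; split => //; rewrite /teq -H; apply/esym/R.
by apply/teq_node; rewrite /= Ep.
Qed.

Lemma move_connected_teql t t' s : teq t t' -> move_connected t s -> move_connected t' s.
Proof.
move=> E H; case: H E => [{}t {}s H|{}t u {}s M Bu C] E.
  by apply: move_connected_refl; rewrite /teq -E.
by apply: move_connected_step Bu C; apply: leaf_move_teql E M.
Qed.

Lemma move_connected_trans t u s : move_connected t u -> move_connected u s -> move_connected t s.
Proof.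
elim=> [{}t {}u E|{}t v {}u M Bv _ IH] C; first exact: move_connected_teql (esym E) C.
by apply: move_connected_step M Bv _; apply: IH.
Qed.

Lemma move_connected_sym t s : nodeall degTbo t -> move_connected t s -> move_connected s t.
Proof.
move=> + C; elim: C => [{}t {}s E _|{}t u {}s M Bu _ IH Bt]; first exact/move_connected_refl/esym.
apply: move_connected_trans (IH Bu) _; apply: move_connected_step (leaf_move_sym M) Bt _; exact: move_connected_refl.
Qed.

Lemma move_connected_ctxl r t s : nodeall degTbo r -> move_connected t s -> move_connected (Node [:: t; r]) (Node [:: s; r]).
Proof.
move=> Br; elim=> [{}t {}s E|{}t u {}s [p [q [Vp Vq E]]] Bu _ IH].
  by apply: move_connected_refl; apply/teq_node; rewrite /= E.
apply: move_connected_step IH; last by rewrite /= Bu Br.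
by exists (0 :: p), (0 :: q); split => //; apply/teq_node; rewrite /= E.
Qed.

Lemma move_connected_ctxr r t s : nodeall degTbo r -> move_connected t s -> move_connected (Node [:: r; t]) (Node [:: r; s]).
Proof.
move=> Br; elim=> [{}t {}s E|{}t u {}s [p [q [Vp Vq E]]] Bu _ IH].
  by apply: move_connected_refl; apply/teq_node; rewrite /= E.
apply: move_connected_step IH; last by rewrite /= Bu Br.
by exists (1 :: p), (1 :: q); split => //; apply/teq_node; rewrite /= E.
Qed.

Fixpoint comb k := if k is k'.+1 then Node [:: comb k'; leafT] else leafT.

Lemma comb_bin k : nodeall degTbo (comb k).
Proof. by elim: k => //= k ->. Qed.

(** Shifting one leaf from the right comb to the left one is a leaf move: both trees extend to two
    combs, each one leaf longer on one side. *)
Lemma move_connected_comb2 i j : move_connected (Node [:: comb i; comb j]) (comb (i + j).+1).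
Proof.
elim: j i => [|j IH] i; first by rewrite addn0; apply: move_connected_refl.
have := IH i.+1; rewrite addSnnS; apply: move_connected_step; last by rewrite /= !comb_bin.
by exists [:: 0], [:: 1].
Qed.

(** Both subtrees are straightened into combs, and the two combs are then merged. *)
Lemma move_connected_comb t : nodeall degTbo t -> move_connected t (comb (num_leaves t).-1).
Proof.
elim/rtree_elim: t => s IH /= /andP [/orP [|] Q A].
  by case: s Q {IH A} => // _; apply: move_connected_refl.
case: s Q A IH => [|x [|y []]] //= _ /and3P [Bx By _] IH.
have Cx := IH x (mem_head _ _) Bx.
have Cy : move_connected y (comb (num_leaves y).-1) by apply: IH => //; rewrite !inE eqxx orbT.
apply: move_connected_trans (move_connected_ctxl By Cx) _.
apply: move_connected_trans (move_connected_ctxr (comb_bin _) Cy) _.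
have := move_connected_comb2 (num_leaves x).-1 (num_leaves y).-1; congr (move_connected _ (comb _)).
by rewrite addn0 -[in RHS](prednK (num_leaves_gt0 x)) -[in RHS](prednK (num_leaves_gt0 y)) addSn addnS.
Qed.

Lemma step_leaf_move_planted n t u T : 0 < n -> in_Tbo n T -> teq T (Node [:: t]) ->
  leaf_move t u -> can_step T (canon (Node [:: u])).
Proof.
move=> n0 HT E [p [q [Vp Vq H]]].
have V0 : valid (Node [:: t]) (0 :: p) by [].
have [v [Vv Sv Ev R]] := teq_transport (esym E) V0.
apply: (@step_leaf_move n T (Node [:: u]) v (0 :: q)) => //.
  by rewrite mem_edges Vv andbT -size_eq0 Sv.
  by rewrite mem_edges.
rewrite /teq -(R (Node [:: subt (Node [:: t]) (0 :: p); leafT])).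
  apply/teq_node; change (perm_eq [:: canon (insert_leaf t p)] [:: canon (insert_leaf u q)]).
  by rewrite H.
by apply/teq_node; rewrite /= -Ev.
Qed.

Lemma in_Tbo_planted n t : in_Tbo n (Node [:: t]) = (num_leaves t == n) && nodeall degTbo t.
Proof. by rewrite in_TboE /= addn0 andbT. Qed.

Lemma leaf_move_num_leaves t u : leaf_move t u -> num_leaves t = num_leaves u.
Proof.
move=> [p [q [Vp Vq /num_leaves_teq H]]].
have I x r : valid x r -> num_leaves (insert_leaf x r) = (num_leaves x).+1.
  move=> V; apply/eqP; rewrite -(eqn_add2r (num_leaves (subt x r))) num_leaves_replace //=.
  by rewrite addn0 addn1 addnS addSn.
by move: H; rewrite !I // => -[].
Qed.

(** * Progress of nonbinary trees *)

(** With Omega at the root, insertion adds two vertices and only the killed leaf disappears, all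
    other trees at the root staying there. *)
Lemma to_root_two n T : 0 < n -> in_To n T -> 2 <= size (children T) ->
  exists2 T', can_step T T' & tree_size T' = (tree_size T).+1.
Proof.
move=> n0 HT S2.
have Hv : [:: 0] \in edges T by rewrite mem_edges /= (ltnW S2).
set T1 := insert_leaf T [:: 0]; have S1 : 1 < size (children T1) by rewrite size_children_insert.
pose c k := nth leafT (children T1) k.
have [V0 L0] := leftmost_leafP (c 0); have [V1 L1] := leftmost_leafP (c 1).
have la : [::] ++ 0 :: leftmost_leaf (c 0) \in leaves T1 by apply: mem_leaves_cons; rewrite //= (ltnW S1).
have lb : [::] ++ 1 :: leftmost_leaf (c 1) \in leaves T1 by apply: mem_leaves_cons; rewrite //= S1.
have St := step_key n0 HT Hv (isT : 0 != 1) la lb isT.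
apply: (ex_intro2 _ _ _ St).
have := tree_size_teq (decomp (isT : 0 != 1) la lb); rewrite tree_size_insert // => E.
apply/eqP; rewrite -eqSS E tree_size_canon /= !map_cat !sumn_cat /= -/(c 0) -/(c 1) !tree_size_spine_tree map_cat sumn_cat /= !addn0.
by rewrite !addn1 !addnS !addnA.
Qed.

(** Take for Omega a vertex with at least three children. Insertion adds two vertices; the killed
    leaf and Omega, absorbed by the root, disappear, and the root receives what hung at Omega. *)
Lemma to_root_one n T : 0 < n -> in_To n T -> size (children T) = 1 -> ~~ in_Tbo n T ->
  exists2 T', can_step T T' & tree_size T' = tree_size T /\ 2 <= size (children T').
Proof.
move=> n0 HT S1 NB.
have Hv : [:: 0] \in edges T by rewrite mem_edges /= S1.
have [p [Vp p0 Sp]] : exists p, [/\ valid T p, p != [::] & 3 <= size (children (subt T p))].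
  move: HT NB; rewrite /in_To /in_Tbo S1 => /andP [-> /allP A] /allPn [p pi Np].
  exists p; move: (pi); rewrite mem_filter mem_addrs => /andP [/andP [-> _] ->]; split => //.
  by rewrite ltn_neqAle eq_sym Np A.
case: T HT S1 Hv NB Vp Sp => -[|t []] // HT _ Hv NB Vp Sp.
case: p p0 Vp Sp => [|[|k] p] // _; rewrite [valid _ _]/= [subt _ _]/= => Vp Sp.
(* The second 0 passes the vertex just inserted on the root edge. *)
pose T1 := insert_leaf (Node [:: t]) [:: 0]; pose w := 0 :: 0 :: p.
have Es : subt T1 w = subt t p by [].
pose c k := nth leafT (children (subt T1 w)) k.
have [V0 L0] := leftmost_leafP (c 0); have [V1 L1] := leftmost_leafP (c 1).
have Vw : valid T1 w by [].
have S2 : 1 < size (children (subt T1 w)) by rewrite Es; apply: ltnW.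
have la : w ++ 0 :: leftmost_leaf (c 0) \in leaves T1.
  by apply: mem_leaves_cons; rewrite ?valid_cat ?subt_cat // Vw [valid _ (_ :: _)]/= (ltnW S2) V0.
have lb : w ++ 1 :: leftmost_leaf (c 1) \in leaves T1.
  by apply: mem_leaves_cons; rewrite ?valid_cat ?subt_cat // Vw [valid _ (_ :: _)]/= S2 V1.
have St := step_key n0 HT Hv (isT : 0 != 1) la lb isT.
apply: (ex_intro2 _ _ _ St).
split; last first.
  rewrite size_children_canon -[children (Node _)]/(_ ++ _) size_cat addn1 ltnS -/T1 -/w Es.
  by rewrite -2!ltnS size_subforest2 // ltnW.
have := tree_size_teq (decomp (isT : 0 != 1) la lb); rewrite tree_size_insert // => E.
apply/eqP; rewrite -2!eqSS E tree_size_canon -/(c 0) -/(c 1) -/w.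
rewrite -/T1; set B := behead (side_trees T1 w); rewrite (_ : side_trees T1 w = [::] :: B); last exact: side_trees_root1.
rewrite /= !map_cat !sumn_cat /= !tree_size_spine_tree !map_cat !sumn_cat /= !addn0.
rewrite !map_cat !sumn_cat /= !tree_size_spine_tree /=; move: (sumn _) (sumn _) (sumn _) (sumn _) => x y z u; lia.
Qed.

(** * Finite Markov chains *)

Section Chain.
Local Open Scope ring_scope.
Local Open Scope classical_set_scope.
Variables (R : realType) (S : finType) (K : S -> S -> R).
Hypotheses (K0 : forall s t, 0 <= K s t) (K1 : forall s, \sum_t K s t = 1).

Definition transop (f : S -> R) (s : S) : R := \sum_t K s t * f t.

(** Duality between laws and functions; convergence is proved on the function side. *)
Lemma sum_law (mu : S -> R) k f :
  \sum_t law K mu k t * f t = \sum_s mu s * iter k transop f s.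
Proof.
elim: k f => [|k IH] f //; rewrite iterSr -IH /=.
under eq_bigr do rewrite mulr_suml.
rewrite exchange_big; apply: eq_bigr => s _; rewrite mulr_sumr.
by apply: eq_bigr => t _; rewrite mulrA.
Qed.

Definition point_mass (c t : S) : R := (t == c)%:R.

Lemma lawE mu k t : law K mu k t = \sum_s mu s * iter k transop (point_mass t) s.
Proof.
rewrite -sum_law (bigD1 t) //= /point_mass eqxx mulr1 big1 ?addr0 // => s /negPf ->.
by rewrite mulr0.
Qed.

Lemma law_ge0 mu k t : (forall s, 0 <= mu s) -> 0 <= law K mu k t.
Proof. by move=> H; elim: k t => [|k IH] t //=; apply: sumr_ge0 => s _; rewrite mulr_ge0. Qed.

Lemma sum_law1 mu k : \sum_t law K mu k t = \sum_s mu s.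
Proof.
elim: k => //= k <-; rewrite exchange_big; apply: eq_bigr => s _.
by rewrite -mulr_sumr K1 mulr1.
Qed.

Lemma transop_le f g : (forall s, f s <= g s) -> forall s, transop f s <= transop g s.
Proof. by move=> H s; apply: ler_sum => t _; rewrite ler_wpM2l. Qed.

Lemma iter_transop_le k f g : (forall s, f s <= g s) ->
  forall s, iter k transop f s <= iter k transop g s.
Proof. by elim: k f g => // k IH f g H /=; apply/transop_le/IH. Qed.

Lemma iter_transop_affine k (x y : R) f s :
  iter k transop (fun t => x + y * f t) s = x + y * iter k transop f s.
Proof.
elim: k s => //= k IH s; rewrite {1}/transop; under eq_bigr do rewrite IH mulrDr mulrCA.
by rewrite big_split /= -mulr_suml K1 mul1r -mulr_sumr.
Qed.

Lemma iter_transop_bound k lo hi f : (forall s, lo <= f s <= hi) ->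
  forall s, lo <= iter k transop f s <= hi.
Proof.
move=> H s; have C x u : iter k transop (fun=> x) u = x.
  elim: k u => //= k IH u; rewrite /transop; under eq_bigr do rewrite IH.
  by rewrite -mulr_suml K1 mul1r.
apply/andP; split; [rewrite -[leLHS](C _ s) | rewrite -[leRHS](C _ s)];
  by apply: iter_transop_le => t; case/andP: (H t).
Qed.

Variable c : S.
Hypotheses (Kcc : 0 < K c c) (lead : forall s, leads K s c).

Lemma iter_transop_ge0 k f : (forall s, 0 <= f s) -> forall s, 0 <= iter k transop f s.
Proof.
elim: k => // k IH H s /=; apply: sumr_ge0 => t _; rewrite mulr_ge0 //.
exact: IH.
Qed.

Lemma point_mass_ge0 t s : 0 <= point_mass t s. Proof. exact: ler0n. Qed.

Lemma pos_step k s t : 0 < K s t -> 0 < iter k transop (point_mass c) t ->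
  0 < iter k.+1 transop (point_mass c) s.
Proof.
move=> H1 H2; rewrite iterS {1}/transop (bigD1 t) //= ltr_wpDr ?mulr_gt0 //.
apply: sumr_ge0 => u _; rewrite mulr_ge0 //; apply: iter_transop_ge0; exact: point_mass_ge0.
Qed.

(** After a path to [c], the loop uses up any number of further steps; this replaces aperiodicity
    and permits a common time for all states. *)
Lemma eventually_pos s : exists m, forall k, (m <= k)%N -> 0 < iter k transop (point_mass c) s.
Proof.
have Pc k : 0 < iter k transop (point_mass c) c.
  by elim: k => [|k IH]; [rewrite /= /point_mass eqxx ltr01 | apply: pos_step IH].
have /connectP [p Hp Ec] := lead s; exists (size p).
elim: p s Hp Ec => [|u p IH] s /= Hp Ec k; first by rewrite -Ec.
case/andP: Hp => Hsu Hp; case: k => // k Hk; apply: pos_step Hsu _.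
exact: IH.
Qed.

Lemma doeblin : exists m d, [/\ 0 < d, d <= 1 & forall s, d <= iter m transop (point_mass c) s].
Proof.
have /fin_all_exists [m Hm] := eventually_pos.
pose M := (\max_s m s)%N.
have [s0 _ Hs] := arg_minP (iter M transop (point_mass c)) (isT : xpredT c).
exists M, (iter M transop (point_mass c) s0); split; last by move=> s; apply: Hs.
  by apply: Hm; apply: leq_bigmax.
have B s : 0 <= point_mass c s <= 1 by rewrite point_mass_ge0 /point_mass lern1 leq_b1.
by case/andP: (iter_transop_bound M B s0).
Qed.

(** From every state the chain is at [c] after [m] steps with probability at least [d], so both
    bounds are pulled towards the same value [g c]. *)
Lemma contract m d : 0 < d -> d <= 1 -> (forall s, d <= iter m transop (point_mass c) s) ->
  forall j f, (forall s, 0 <= f s <= 1) -> exists lo hi, hi - lo = (1 - d) ^+ j /\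
    forall s, lo <= iter (j * m) transop f s <= hi.
Proof.
move=> d0 d1 Hd; elim=> [|j IH] f Hf; first by exists 0, 1; rewrite subr0 expr0.
have [lo [hi [E B]]] := IH f Hf; set g := iter (j * m) transop f in B.
(* These come from comparing [g] with the functions equal to [g c] at [c] and constantly [lo],
   respectively [hi], elsewhere. *)
exists (lo + (g c - lo) * d), (hi + (g c - hi) * d); split.
  by rewrite exprS -E; ring.
move=> s; rewrite mulSn iterD -/g.
have /andP [B1 B2] := B c.
apply/andP; split.
  apply: (@le_trans _ _ (lo + (g c - lo) * iter m transop (point_mass c) s)).
    by rewrite lerD2l ler_wpM2l ?subr_ge0.
  rewrite -iter_transop_affine; apply: iter_transop_le => t; rewrite /point_mass.
  case: eqP => [->|_]; first by rewrite mulr1 addrC subrK.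
  by rewrite mulr0 addr0; case/andP: (B t).
apply: (@le_trans _ _ (hi + (g c - hi) * iter m transop (point_mass c) s)).
  rewrite -iter_transop_affine; apply: iter_transop_le => t; rewrite /point_mass.
  case: eqP => [->|_]; first by rewrite mulr1 addrC subrK.
  by rewrite mulr0 addr0; case/andP: (B t).
by rewrite lerD2l ler_wnM2l ?subr_le0.
Qed.

(** Every late law at [t] is an average of values in one short interval. Uniformity in both time and
    initial law gives existence of the limit and its independence of the start. *)
Lemma law_cauchy t (e : R) : 0 < e -> exists N, forall k k' mu mu', (N <= k)%N -> (N <= k')%N ->
  is_distr mu -> is_distr mu' -> `|law K mu k t - law K mu' k' t| <= e.
Proof.
move=> e0; have [m [d [d0 d1 Hd]]] := doeblin.
have [j Hj] : exists j, (1 - d) ^+ j <= e.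
  have : `|1 - d| < 1 by rewrite ger0_norm ?subr_ge0 // ltrBlDr ltrDl.
  move/cvg_expr/cvgrPdist_le => /(_ _ e0) [N _ HN]; exists N.
  have := HN N (leqnn N); rewrite /= sub0r normrN; apply: le_trans; exact: ler_norm.
have Hf s : 0 <= point_mass t s <= 1 by rewrite point_mass_ge0 /point_mass lern1 leq_b1.
have [lo [hi [E B]]] := contract d0 d1 Hd j Hf.
have Bk mu k : (j * m <= k)%N -> is_distr mu -> lo <= law K mu k t <= hi.
  move=> Hk [mu0 mu1]; rewrite lawE -(subnK Hk).
  have Bs s := @iter_transop_bound (k - j * m) lo hi _ B s.
  have W x : x = \sum_s mu s * x by rewrite -mulr_suml mu1 mul1r.
  by apply/andP; split; [rewrite [leLHS]W | rewrite [leRHS]W]; apply: ler_sum => s _;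
    rewrite ler_wpM2l // iterD; case/andP: (Bs s).
exists (j * m)%N => k k' mu mu' Hk Hk' Hmu Hmu'.
have /andP [A1 A2] := Bk _ _ Hk Hmu; have /andP [A3 A4] := Bk _ _ Hk' Hmu'.
apply: le_trans Hj; rewrite -E ler_norml; apply/andP; split.
  by rewrite opprB lerB.
by rewrite lerB.
Qed.

Lemma point_mass_distr : is_distr (point_mass c).
Proof.
split; first exact: point_mass_ge0.
by rewrite (bigD1 c) //= /point_mass eqxx big1 ?addr0 // => s /negPf ->.
Qed.

Lemma chain_converges : exists pi : S -> R, [/\ stationary K pi,
  (forall pi', stationary K pi' -> pi' = pi) &
  (forall mu0, is_distr mu0 -> forall t, (fun k => law K mu0 k t) @ \oo --> pi t)].
Proof.
have Cv t : cvgn (fun k => law K (point_mass c) k t).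
  apply/cauchy_cvgP/cauchy_exP => e e0.
  have e20 : 0 < e / 2 by rewrite divr_gt0.
  have [N HN] := law_cauchy t e20.
  exists (law K (point_mass c) N t); exists N => // k /= Hk.
  rewrite /ball /=; apply: le_lt_trans (HN N k _ _ (leqnn N) Hk point_mass_distr point_mass_distr) _.
  by rewrite ltr_pdivrMr // ltr_pMr // ltr1n.
pose pi t := limn (fun k => law K (point_mass c) k t).
have L mu : is_distr mu -> forall t, (fun k => law K mu k t) @ \oo --> pi t.
  move=> Hmu t; apply/cvgrPdist_le => e e0.
  have e20 : 0 < e / 2 by rewrite divr_gt0.
  have [N HN] := law_cauchy t e20.
  have /cvgrPdist_le /(_ _ e20) [N' _ HN'] := Cv t.
  exists N => // k /= Hk.
  have H1 := HN' (maxn N N') (leq_maxr _ _).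
  have H2 := HN (maxn N N') k _ _ (leq_maxl _ _) Hk point_mass_distr Hmu.
  rewrite -(subrKA (law K (point_mass c) (maxn N N') t)).
  by apply: le_trans (ler_normD _ _) _; rewrite [leRHS]splitr lerD.
have sum_cvg (f : S -> nat -> R) (g : S -> R) : (forall s, f s k @[k --> \oo] --> g s) ->
    (\sum_s f s k) @[k --> \oo] --> \sum_s g s.
  by move=> H; apply: cvg_big => //; exact: add_continuous.
have St : stationary K pi.
  split.
    split=> [s|].
      apply: limr_ge; first exact: Cv.
      by apply: nearW => k; apply: law_ge0 => u; apply: point_mass_ge0.
    have H1 := sum_cvg _ _ (L _ point_mass_distr).
    have H2 : (fun k => \sum_s law K (point_mass c) k s) @ \oo --> (1 : R).
      under eq_fun do rewrite sum_law1 (proj2 point_mass_distr); exact: cvg_cst.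
    exact: cvg_unique H1 H2.
  (* Invariance of the limit: the shifted laws converge to [pi], and also to [pi] pushed by the
     kernel, the sum being finite. *)
  move=> t; have H1 : (fun k => law K (point_mass c) k.+1 t) @ \oo --> pi t.
    by have := L _ point_mass_distr t; rewrite -cvg_shiftS.
  have H2 : (fun k => law K (point_mass c) k.+1 t) @ \oo --> \sum_s pi s * K s t.
    by apply: sum_cvg => s; apply: cvgMr_tmp; apply: L; apply: point_mass_distr.
  exact: cvg_unique H2 H1.
exists pi; split => // pi' [D' S'].
apply/funext => t; have H := L _ D' t.
(* A stationary law does not move, so its limit is itself; this is uniqueness. *)
have E k : law K pi' k = pi'.
  elim: k => //= k IH; apply/funext => u; rewrite -[RHS]S'.
  by apply: eq_bigr => s _; rewrite IH.
have H' : (fun k => law K pi' k t) @ \oo --> pi' t.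
  by under eq_fun do rewrite E; exact: cvg_cst.
exact: cvg_unique H' H.
Qed.
End Chain.

(** * The chain on tree states *)

Section TreeChain.
Variables (R : realType) (n : nat).
Hypothesis n2 : 2 <= n.
Let K := @P R n.
Let n0 : 0 < n. Proof. exact: leq_trans n2. Qed.

Lemma stateP (s : state n) : is_state n (ssval s).
Proof. by rewrite -mem_state_list //; apply: ssvalP. Qed.

Lemma state_To (s : state n) : in_To n (ssval s).
Proof. by case/andP: (stateP s). Qed.

Lemma state_canon (s : state n) : canon (ssval s) = ssval s.
Proof. by case/andP: (stateP s) => /eqP. Qed.

Lemma state_ex t : is_state n t -> exists s : state n, ssval s = t.
Proof. by rewrite -mem_state_list // => H; exists (SeqSub H). Qed.

Lemma K_gt0 s t : (0 < K s t)%R <-> can_step (ssval s) (ssval t).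
Proof. exact: trans_prob_gt0. Qed.

Lemma leads_step s t : can_step (ssval s) (ssval t) -> leads K s t.
Proof. by move/K_gt0 => H; apply: connect1. Qed.

Lemma leads_trans s t u : leads K s t -> leads K t u -> leads K s u.
Proof. exact: connect_trans. Qed.

Lemma binary_planted s : s \in binary_states n -> exists t,
  [/\ ssval s = canon (Node [:: t]), nodeall degTbo t & num_leaves t = n].
Proof.
rewrite inE => Hs; have := Hs; rewrite in_TboE => /and3P [_ S1 _].
have := state_canon s; case: (ssval s) S1 Hs => -[|t []] // _ Hs Ec.
by exists t; move: Hs; rewrite in_Tbo_planted => /andP [/eqP].
Qed.

Lemma planted_state t : nodeall degTbo t -> num_leaves t = n ->
  exists2 s : state n, s \in binary_states n & ssval s = canon (Node [:: t]).
Proof.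
move=> Bt Lt; have B : in_Tbo n (canon (Node [:: t])).
  by rewrite in_Tbo_canon in_Tbo_planted Lt eqxx.
have [|s Es] := @state_ex (canon (Node [:: t])).
  by rewrite /is_state canon_id eqxx in_Tbo_To.
by exists s => //; rewrite inE Es.
Qed.

Lemma move_connected_leads t u : move_connected t u -> nodeall degTbo t -> num_leaves t = n -> forall x y : state n,
  ssval x = canon (Node [:: t]) -> ssval y = canon (Node [:: u]) -> leads K x y.
Proof.
elim=> [{}t {}u E|{}t u' {}u M Bu _ IH] Bt Lt x y Ex Ey.
  suff -> : x = y by apply: connect0.
  by apply: val_inj; rewrite /= Ex Ey; apply/teq_node; rewrite /= E.
have Lu : num_leaves u' = n by rewrite -(leaf_move_num_leaves M).
have [z _ Ez] := planted_state Bu Lu.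
apply: (leads_trans (t := z)); last exact: IH.
apply: leads_step; rewrite Ez; apply: (@step_leaf_move_planted n t) => //.
  by rewrite Ex in_Tbo_canon in_Tbo_planted Lt eqxx.
by rewrite Ex; apply: teq_canon.
Qed.

Lemma binary_leads x y : x \in binary_states n -> y \in binary_states n -> leads K x y.
Proof.
move=> /binary_planted [t [Ex Bt Lt]] /binary_planted [u [Ey Bu Lu]].
apply: (@move_connected_leads t u) => //; apply: move_connected_trans (move_connected_comb Bt) _.
by rewrite Lt -Lu; apply: move_connected_sym => //; apply: move_connected_comb.
Qed.

(** The trivial leaf move: the inserted leaf is the one killed. *)
Lemma binary_loop x : x \in binary_states n -> (0 < K x x)%R.
Proof.
move=> xB; have [t [Ex Bt Lt]] := binary_planted xB.
apply/K_gt0; rewrite {2}Ex; apply: (@step_leaf_move_planted n t) => //.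
- by move: xB; rewrite inE.
- by rewrite Ex; apply: teq_canon.
- by exists [::], [::].
Qed.

(** Sizes are at most [2 * n], and a nonbinary state increases its size in one or two steps. *)
Lemma reach_binary x : exists2 y, y \in binary_states n & leads K x y.
Proof.
have [m] := ubnP (2 * n - tree_size (ssval x)); elim: m x => // m IH x Hm.
case: (boolP (x \in binary_states n)) => xB; first by exists x => //; apply: connect0.
(* Stated for any [y] no smaller than [x], so that it also serves after the size-preserving step of
   [to_root_one]. *)
have two y : 2 <= size (children (ssval y)) -> tree_size (ssval x) <= tree_size (ssval y) ->
    exists2 z, z \in binary_states n & leads K y z.
  move=> S2 xy; have [T' St Ts] := to_root_two n0 (state_To y) S2.
  have [z Ez] := state_ex (step_state n0 (state_To y) St).
  have Hz := tree_size_le n0 (state_To z).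
  have [|u uB zu] := IH z; first by rewrite Ez Ts in Hz *; lia.
  exists u => //; apply: leads_trans zu; apply: leads_step; by rewrite Ez.
case: (ltngtP (size (children (ssval x))) 1) => S1.
- have [] := in_To_nonleaf n0 (state_To x); move: S1; rewrite ltnS leqn0 size_eq0.
  by move=> ->.
- exact: two.
- have NB : ~~ in_Tbo n (ssval x) by move: xB; rewrite inE.
  have [T' St [Ts S2]] := to_root_one n0 (state_To x) S1 NB.
  have [y Ey] := state_ex (step_state n0 (state_To x) St).
  have [||z zB yz] := two y; [by rewrite Ey | by rewrite Ey Ts |].
  exists z => //; apply: leads_trans yz; apply: leads_step; by rewrite Ey.
Qed.

Lemma binary_closed : closed_class K (binary_states n).
Proof.
by move=> s t; rewrite !inE => sB /K_gt0; apply: step_Tbo.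
Qed.

Lemma closed_leads (C : {set state n}) s t : closed_class K C -> s \in C -> leads K s t -> t \in C.
Proof.
move=> HC sC /connectP [p Hp ->]; elim: p s sC Hp => //= u p IH s sC /andP [su Hp].
by apply: IH Hp; apply: HC su.
Qed.

Lemma binary_ex : exists c, c \in binary_states n.
Proof.
have [|c cB _] := @planted_state (comb n.-1) (comb_bin _); last by exists c.
have L k : num_leaves (comb k) = k.+1 by elim: k => //= k ->; rewrite addn0 addn1.
by rewrite L prednK.
Qed.

Lemma K_ge0 s t : (0 <= K s t)%R. Proof. exact: trans_prob_ge0. Qed.
Lemma K_sum s : (\sum_t K s t = 1)%R.
Proof. exact: trans_prob_sum (state_To s). Qed.

End TreeChain.

Local Open Scope ring_scope.
Local Open Scope classical_set_scope.

Theorem mainTheorem6 (R : realType) (n : nat) (hn : (2 <= n)%N) :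
  let K := @P R n in
  [/\ comm_class K (binary_states n) /\ closed_class K (binary_states n),
      (forall C : {set state n}, comm_class K C -> closed_class K C ->
         C = binary_states n) &
      exists pi : state n -> R,
        [/\ stationary K pi,
            (forall pi' : state n -> R, stationary K pi' -> pi' = pi),
            (forall s, s \notin binary_states n -> pi s = 0) &
            (forall mu0 : state n -> R, is_distr mu0 ->
               forall t, (fun k => law K mu0 k t) @ \oo --> pi t)]].
Proof.
move=> K.
have [c cB] := binary_ex hn.
have Cl : closed_class K (binary_states n) := binary_closed hn.
have Lc s : leads K s c.
  have [y yB sy] := reach_binary R hn s.
  exact: leads_trans sy (binary_leads _ hn yB cB).
have Bc : binary_states n = [set t | communicate K c t]%SET.
  apply/setP => t; rewrite [RHS]inE /communicate Lc andbT; apply/idP/idP.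
    exact: binary_leads.
  exact: closed_leads.
split; first by split => //; exists c.
(* A closed class contains whatever its members lead to, hence [c], and so it is the class of
   [c]. *)
- move=> C [s ->] HC; rewrite Bc; apply/setP => t.
  have cC : c \in [set t | communicate K s t]%SET.
    apply: closed_leads (HC) _ (Lc s); rewrite inE /communicate.
    by rewrite /leads connect0.
  move: cC; rewrite !inE /communicate => /andP [sc cs]; rewrite !Lc andbT.
  apply/andP/idP => [[st _]|ct]; first exact: leads_trans cs st.
  by split; [exact: leads_trans sc ct | exact: leads_trans (Lc t) cs].
have [pi [St Un Cv]] := chain_converges (fun s t => K_ge0 R s t) (K_sum R hn) (binary_loop R hn cB) Lc.
exists pi; split => // s sB.
(* Started at the binary state [c], the chain never leaves the binary states, so the limit vanishes
   outside them. *)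
have Z k : law K (point_mass R c) k s = 0.
  elim: k s sB => [|k IH] s sB /=.
    by rewrite /point_mass; case: eqP => // E; rewrite E cB in sB.
  apply: big1 => u _; case: (boolP (u \in binary_states n)) => uB; last by rewrite IH ?mul0r.
  suff -> : K u s = 0 by rewrite mulr0.
  apply/eqP; have := K_ge0 R u s; rewrite le_eqVlt eq_sym => /orP [//|/Cl H].
  by rewrite H in sB.
have := Cv _ (point_mass_distr R c) s; under eq_fun do rewrite Z; move=> H.
exact: cvg_unique H (cvg_cst _).
Qed.
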